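(* Let $\beta=(\beta_n)_{n\ge0}$ be a sequence of positive numbers which is bounded above and slowly oscillating. Then every symbol $\phi$ that extends analytically to a neighborhood of the closed unit disk $\overline{\mathbb D}$ induces a bounded composition operator $C_\phi$ on $H^2(\beta)$.
   Context: $H^2(\beta)$ is the Hilbert space of analytic functions $f(z)=\sum_{n\ge0}a_nz^n$ on the unit disk $\mathbb D$ with $\|f\|^2=\sum_{n\ge0}|a_n|^2\beta_n<\infty$. A symbol is a non-constant analytic map $\phi:\mathbb D\to\mathbb D$ and $C_\phi f=f\circ\phi$. $\beta$ is slowly oscillating if there are constants $0<C_1<C_2$ with $C_1\le\beta_m/\beta_n\le C_2$ whenever $n\ge1$ and $n/2\le m\le2n$. *)

(* Defs.v *)
From Stdlib Require Import Reals.
From Coquelicot Require Import Coquelicot.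
Open Scope R_scope.

Definition weight_pos (beta : nat -> R) : Prop := forall n, 0 < beta n.

Definition weight_bounded_above (beta : nat -> R) : Prop :=
  exists K : R, forall n, beta n <= K.

Definition slowly_oscillating (beta : nat -> R) : Prop :=
  exists C1 C2 : R, 0 < C1 /\ C1 < C2 /\
    forall n m : nat, (1 <= n)%nat -> (n <= 2 * m)%nat -> (m <= 2 * n)%nat ->
      C1 <= beta m / beta n <= C2.

(* f(z) = sum a_n z^n is an element of H^2(beta): an analytic function on D
   (its power series converges on D) with sum |a_n|^2 beta_n < oo. *)
Definition in_H2 (beta : nat -> R) (a : nat -> C) : Prop :=
  ex_series (fun n => (Cmod (a n)) ^ 2 * beta n) /\
  (forall z : C, Cmod z < 1 -> @ex_pseries C_AbsRing C_NormedModule a z).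

Definition H2norm (beta : nat -> R) (a : nat -> C) : R :=
  sqrt (Series (fun n => (Cmod (a n)) ^ 2 * beta n)).

(* A symbol: phi maps D into D and is non-constant on D (analytic on D is
   implied below by analyticity on a neighbourhood of the closed disk). *)
Definition maps_disk_into_disk (phi : C -> C) : Prop :=
  forall z : C, Cmod z < 1 -> Cmod (phi z) < 1.

Definition nonconstant_on_disk (phi : C -> C) : Prop :=
  exists z1 z2 : C, Cmod z1 < 1 /\ Cmod z2 < 1 /\ phi z1 <> phi z2.

Definition analytic_near_closed_disk (phi : C -> C) : Prop :=
  exists U : C -> Prop, @open C_UniformSpace U /\
    (forall z : C, Cmod z <= 1 -> U z) /\
    (forall z : C, U z -> @ex_derive C_AbsRing C_NormedModule phi z).

(* C_phi is a bounded operator on H^2(beta): for every f in H^2(beta),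
   f o phi is in H^2(beta) (given by its Taylor coefficients b on D) and
   ||f o phi|| <= M ||f||. *)
Definition bounded_composition (beta : nat -> R) (phi : C -> C) : Prop :=
  exists M : R, 0 <= M /\
    forall a : nat -> C, in_H2 beta a ->
      exists b : nat -> C, in_H2 beta b /\
        H2norm beta b <= M * H2norm beta a /\
        (forall z : C, Cmod z < 1 ->
           exists w : C, @is_pseries C_AbsRing C_NormedModule a (phi z) w /\
                         @is_pseries C_AbsRing C_NormedModule b z w).

(* Main.v *)
Require Import Defs.
From Stdlib Require Import Reals Lra Lia ClassicalEpsilon.
From Coquelicot Require Import Coquelicot.
Open Scope R_scope.

(** In the monomial basis, [C_phi] is the matrix of the Taylor coefficients
    [A n m] of [phi ^ n]. Since [phi] is bounded by some [M < 1] on a small disk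
    and by a constant [K] on a disk of radius [R > 1], Cauchy's estimates give
    [|A n m| <= M ^ n * 2 ^ m] and [|A n m| <= K ^ n / R ^ m], so [A n m] is at
    most [lam ^ (n + m)], with [lam < 1], unless [n] and [m] are comparable. A
    slowly oscillating weight beats every geometric sequence, so this part of
    the matrix is bounded on the weighted space. On the part where [n] and [m]
    are comparable the weight is constant up to a factor on dyadic blocks, and
    the boundedness of [C_phi] on the unweighted Hardy space (Littlewood's
    subordination) applies block by block. *)

(** * Complex differentiability *)

(** The image of the disk may touch the unit circle, so [phi] is bounded by some [M < 1] only on a
    smaller disk, and the resulting estimate decays only when the power [n] dominates the degree
    [m]. The extension beyond the circle supplies the opposite regime, at the price of a factor
    [K ^ n]. In between, the two Cauchy estimates give no decay at all, so an operator bound has to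
    replace entrywise estimates there. Comparability is measured with [Nat.log2], because then each
    index lies in boundedly many windows.

    The symbol is only assumed complex differentiable at each point, with no continuity of the
    derivative, so Cauchy's theory has to start from Goursat's bisection. The integrals needed are
    all means over circles centred at 0; polar rectangles make Cauchy's theorem the statement that
    such means do not depend on the radius.

    All matrix inequalities are proved for finite sections, with constants independent of the size,
    and limits are taken only at the end. *)

Ltac Cring := match goal with |- @eq _ ?a ?b => change (@eq C a b); ring end.

Notation continuousC := (@continuous C_UniformSpace C_UniformSpace).

Lemma Cmod_of_ball (x y : C) (e : posreal) :
  @ball C_UniformSpace x e y -> Cmod (y - x)%C < 2 * e.
Proof.
  intros H. apply Rlt_le_trans with (sqrt 2 * e).
  - exact (C_NormedModule_mixin_compat2 x y e H).
  - apply Rmult_le_compat_r. apply Rlt_le, cond_pos.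
    rewrite <- (sqrt_square 2) at 2 by lra. apply sqrt_le_1_alt. lra.
Qed.

Lemma ball_of_Cmod (x y : C) (e : R) :
  Cmod (y - x)%C < e -> @ball C_UniformSpace x e y.
Proof. exact (C_NormedModule_mixin_compat1 x y e). Qed.

(** Balls of [C_UniformSpace] are squares, since it is a product space. They compare with disks up
    to the factor [sqrt 2], rounded up to 2. *)
Lemma locally_Cmod (x : C) (P : C -> Prop) :
  @locally C_UniformSpace x P <->
  exists d : R, 0 < d /\ forall y, Cmod (y - x)%C < d -> P y.
Proof.
  split.
  - intros [e He]. exists e. split. apply cond_pos.
    intros y Hy. apply He. now apply ball_of_Cmod.
  - intros [d [Hd H]].
    assert (Hd2 : 0 < d / 2) by lra.
    exists (mkposreal _ Hd2). intros y Hy. apply H.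
    apply Cmod_of_ball in Hy. simpl in Hy. lra.
Qed.

Lemma continuous_Cmod {U : UniformSpace} (f : U -> C) (x : U) :
  @continuous U C_UniformSpace f x <->
  forall e, 0 < e -> locally x (fun y => Cmod (f y - f x)%C < e).
Proof.
  split.
  - intros H e He. apply (H (fun y => Cmod (y - f x)%C < e)).
    apply locally_Cmod. exists e. auto.
  - intros H P HP. apply locally_Cmod in HP. destruct HP as [d [Hd HP]].
    unfold filtermap. generalize (H d Hd). apply filter_imp. auto.
Qed.

Lemma Ccontinuous_const {U : UniformSpace} (c : C) (x : U) :
  @continuous U C_UniformSpace (fun _ => c) x.
Proof. apply continuous_const. Qed.

Lemma Ccontinuous_plus {U : UniformSpace} (f g : U -> C) (x : U) :
  @continuous U C_UniformSpace f x -> @continuous U C_UniformSpace g x ->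
  @continuous U C_UniformSpace (fun y => (f y + g y)%C) x.
Proof. intros Hf Hg. exact (@continuous_plus U C_AbsRing C_NormedModule f g x Hf Hg). Qed.

Lemma Ccontinuous_minus {U : UniformSpace} (f g : U -> C) (x : U) :
  @continuous U C_UniformSpace f x -> @continuous U C_UniformSpace g x ->
  @continuous U C_UniformSpace (fun y => (f y - g y)%C) x.
Proof. intros Hf Hg. exact (@continuous_minus U C_AbsRing C_NormedModule f g x Hf Hg). Qed.

(** [C] carries two uniform structures, as a product and as a ring with absolute value. They have
    the same neighbourhoods, which allows the product rule of the second to be used for the
    first. *)
Lemma continuous_AbsRing_C {U : UniformSpace} (f : U -> C) (x : U) :
  @continuous U (AbsRing_UniformSpace C_AbsRing) f x <->
  @continuous U C_UniformSpace f x.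
Proof.
  split; intros H P HP; apply H; now apply locally_C.
Qed.

Lemma Ccontinuous_mult {U : UniformSpace} (f g : U -> C) (x : U) :
  @continuous U C_UniformSpace f x -> @continuous U C_UniformSpace g x ->
  @continuous U C_UniformSpace (fun y => (f y * g y)%C) x.
Proof.
  intros Hf Hg. apply continuous_AbsRing_C in Hf. apply continuous_AbsRing_C in Hg.
  apply continuous_AbsRing_C. exact (@continuous_mult U C_AbsRing f g x Hf Hg).
Qed.

Lemma Ccontinuous_pow {U : UniformSpace} (f : U -> C) (n : nat) (x : U) :
  @continuous U C_UniformSpace f x ->
  @continuous U C_UniformSpace (fun y => (f y ^ n)%C) x.
Proof.
  intros Hf. induction n as [|n IH]; simpl.
  - apply Ccontinuous_const.
  - now apply Ccontinuous_mult.
Qed.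

Lemma Cmod_minus_sym (x y : C) : Cmod (x - y)%C = Cmod (y - x)%C.
Proof. rewrite <- Cmod_opp. f_equal. ring. Qed.

Lemma Cmod_triangle_minus (x y : C) : Cmod x - Cmod y <= Cmod (x - y)%C.
Proof.
  generalize (Cmod_triangle (x - y) y). replace (x - y + y)%C with x by ring. lra.
Qed.

Lemma Ccontinuous_inv {U : UniformSpace} (f : U -> C) (x : U) :
  f x <> 0%C -> @continuous U C_UniformSpace f x ->
  @continuous U C_UniformSpace (fun y => (/ f y)%C) x.
Proof.
  intros Hx Hf. rewrite continuous_Cmod in Hf |- *.
  intros e He. set (a := Cmod (f x)).
  assert (Ha : 0 < a) by now apply Cmod_gt_0.
  (* The first bound keeps [f y] at distance [a / 2] from 0; the second then makes the difference of
     the inverses smaller than [e]. *)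
  assert (H1 : 0 < Rmin (a / 2) (e * a * a / 2)).
  { apply Rmin_pos. lra. repeat apply Rmult_lt_0_compat; lra. }
  generalize (Hf _ H1). apply filter_imp. intros y Hy.
  assert (Hy1 := Rlt_le_trans _ _ _ Hy (Rmin_l _ _)).
  assert (Hy2 := Rlt_le_trans _ _ _ Hy (Rmin_r _ _)).
  assert (Hb : a / 2 < Cmod (f y)).
  { generalize (Cmod_triangle_minus (f x) (f y)). rewrite Cmod_minus_sym. fold a. lra. }
  assert (Hfy : f y <> 0%C) by (apply Cmod_gt_0; lra).
  replace (/ f y - / f x)%C with ((f x - f y) / (f y * f x))%C by (field; auto).
  rewrite Cmod_div by now apply Cmult_neq_0.
  rewrite Cmod_mult, Cmod_minus_sym. fold a.
  apply Rmult_lt_reg_r with (Cmod (f y) * a).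
  - apply Rmult_lt_0_compat; lra.
  - unfold Rdiv. rewrite Rmult_assoc, Rinv_l, Rmult_1_r.
    + apply Rlt_trans with (1 := Hy2).
      assert (e * a * (a / 2) < e * a * Cmod (f y)).
      { apply Rmult_lt_compat_l; auto. now apply Rmult_lt_0_compat. }
      lra.
    + apply Rgt_not_eq. apply Rmult_lt_0_compat; lra.
Qed.

Lemma Ccontinuous_conj {U : UniformSpace} (f : U -> C) (x : U) :
  @continuous U C_UniformSpace f x ->
  @continuous U C_UniformSpace (fun y => Cconj (f y)) x.
Proof.
  rewrite !continuous_Cmod. intros Hf e He. generalize (Hf e He).
  apply filter_imp. intros y Hy. now rewrite <- Cminus_conj, Cmod_conj.
Qed.

Lemma continuous_pairC {U : UniformSpace} (f g : U -> R) (x : U) :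
  continuous f x -> continuous g x ->
  @continuous U C_UniformSpace (fun y => (f y, g y)) x.
Proof.
  intros Hf Hg P [e HP].
  assert (H1 := Hf _ (locally_ball (f x) e)). assert (H2 := Hg _ (locally_ball (g x) e)).
  unfold filtermap in *. generalize (filter_and _ _ H1 H2). apply filter_imp.
  intros y [A B]. apply HP. split; auto.
Qed.

(* Caratheodory's form of complex differentiability: products and quotients
   then only need the algebra of continuous functions. *)
Definition holo (f : C -> C) (z : C) : Prop :=
  exists psi : C -> C, continuousC psi z /\
    forall y, (f y - f z = psi y * (y - z))%C.

Lemma holo_continuous (f : C -> C) (z : C) : holo f z -> continuousC f z.
Proof.
  intros [psi [Hc H]].
  apply continuous_ext with (fun y => (f z + psi y * (y - z))%C).
  - intros y. rewrite <- H. Cring.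
  - apply Ccontinuous_plus. apply Ccontinuous_const.
    apply Ccontinuous_mult; auto.
    apply Ccontinuous_minus. apply continuous_id. apply Ccontinuous_const.
Qed.

(** The witness is the difference quotient, completed at [z] by the derivative [l]. *)
Lemma holo_of_limit (f : C -> C) (z l : C) :
  (forall e, 0 < e -> exists d, 0 < d /\ forall y, Cmod (y - z)%C < d ->
     Cmod (f y - f z - l * (y - z))%C <= e * Cmod (y - z)%C) ->
  holo f z.
Proof.
  intros H.
  exists (fun y => if Ceq_dec y z then l else ((f y - f z) / (y - z))%C). split.
  - apply continuous_Cmod. intros e He.
    destruct (H (e / 2)) as [d [Hd Hl]]; [lra|].
    apply locally_Cmod. exists d. split; auto. intros y Hy.
    destruct (Ceq_dec z z) as [_|N]; [|now elim N].
    destruct (Ceq_dec y z) as [E|N].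
    + replace (l - l)%C with (RtoC 0) by ring. rewrite Cmod_0. auto.
    + assert (Hyz : (y - z)%C <> 0%C) by now apply Cminus_eq_contra.
      replace ((f y - f z) / (y - z) - l)%C
        with ((f y - f z - l * (y - z)) / (y - z))%C by (field; auto).
      rewrite Cmod_div by auto.
      assert (Hp : 0 < Cmod (y - z)%C) by now apply Cmod_gt_0.
      apply Rle_lt_trans with (e / 2); [|lra].
      apply Rmult_le_reg_r with (Cmod (y - z)%C); auto.
      unfold Rdiv at 1. rewrite Rmult_assoc, Rinv_l, Rmult_1_r by lra. auto.
  - intros y. destruct (Ceq_dec y z) as [E|N].
    + rewrite E. ring.
    + field. now apply Cminus_eq_contra.
Qed.

Lemma holo_limit (f : C -> C) (z : C) :
  holo f z -> exists l, forall e, 0 < e -> exists d, 0 < d /\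
     forall y, Cmod (y - z)%C < d ->
     Cmod (f y - f z - l * (y - z))%C <= e * Cmod (y - z)%C.
Proof.
  intros [psi [Hc H]]. exists (psi z). intros e He.
  rewrite continuous_Cmod in Hc. specialize (Hc e He). apply locally_Cmod in Hc.
  destruct Hc as [d [Hd Hc]]. exists d. split; auto. intros y Hy.
  rewrite H. replace (psi y * (y - z) - psi z * (y - z))%C with ((psi y - psi z) * (y - z))%C by ring.
  rewrite Cmod_mult. apply Rmult_le_compat_r. apply Cmod_ge_0. left. auto.
Qed.

Lemma holo_ex_derive (f : C -> C) (z : C) :
  @ex_derive C_AbsRing C_NormedModule f z -> holo f z.
Proof.
  intros [l [_ Hl]]. apply holo_of_limit with l. intros e He.
  specialize (Hl z (fun P HP => HP) (mkposreal e He)).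
  apply locally_C, locally_Cmod in Hl. destruct Hl as [d [Hd Hl]]. exists d. split; auto.
  intros y Hy. specialize (Hl y Hy). simpl in Hl.
  rewrite (Cmult_comm l).
  exact Hl.
Qed.

Lemma holo_id (z : C) : holo (fun y => y) z.
Proof. exists (fun _ => RtoC 1). split. apply Ccontinuous_const. intros y; ring. Qed.

Lemma holo_const (c z : C) : holo (fun _ => c) z.
Proof. exists (fun _ => RtoC 0). split. apply Ccontinuous_const. intros y; ring. Qed.

Lemma holo_plus (f g : C -> C) (z : C) :
  holo f z -> holo g z -> holo (fun y => (f y + g y)%C) z.
Proof.
  intros [p [Hp Ep]] [q [Hq Eq]]. exists (fun y => (p y + q y)%C). split.
  now apply Ccontinuous_plus. intros y.
  replace (f y + g y - (f z + g z))%C with ((f y - f z) + (g y - g z))%C by ring.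
  rewrite Ep, Eq. ring.
Qed.

Lemma holo_mult (f g : C -> C) (z : C) :
  holo f z -> holo g z -> holo (fun y => (f y * g y)%C) z.
Proof.
  intros Hf Hg. assert (Cg := holo_continuous _ _ Hg).
  destruct Hf as [p [Hp Ep]], Hg as [q [Hq Eq]].
  exists (fun y => (p y * g y + f z * q y)%C). split.
  - apply Ccontinuous_plus; apply Ccontinuous_mult; auto. apply Ccontinuous_const.
  - intros y.
    replace (f y * g y - f z * g z)%C with ((f y - f z) * g y + f z * (g y - g z))%C by ring.
    rewrite Ep, Eq. ring.
Qed.

Lemma holo_minus (f g : C -> C) (z : C) :
  holo f z -> holo g z -> holo (fun y => (f y - g y)%C) z.
Proof.
  intros [p [Hp Ep]] [q [Hq Eq]]. exists (fun y => (p y - q y)%C). split.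
  now apply Ccontinuous_minus. intros y.
  replace (f y - g y - (f z - g z))%C with ((f y - f z) - (g y - g z))%C by ring.
  rewrite Ep, Eq. ring.
Qed.

Lemma holo_pow (f : C -> C) (n : nat) (z : C) :
  holo f z -> holo (fun y => (f y ^ n)%C) z.
Proof.
  intros Hf. induction n as [|n IH]; simpl. apply holo_const. now apply holo_mult.
Qed.

(** Carathéodory's identity is required at every [y], but the natural slope function satisfies it
    only where [f y] is nonzero. The limit form is local, so it avoids the zeros of [f]. *)
Lemma holo_inv (f : C -> C) (z : C) :
  f z <> 0%C -> holo f z -> holo (fun y => (/ f y)%C) z.
Proof.
  intros Hz Hf. assert (Cf := holo_continuous _ _ Hf).
  destruct Hf as [p [Hp Ep]].
  assert (Cq : continuousC (fun y => (- (1) * p y * / (f y * f z))%C) z).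
  { apply Ccontinuous_mult. apply Ccontinuous_mult; auto. apply Ccontinuous_const.
    apply Ccontinuous_inv. now apply Cmult_neq_0.
    apply Ccontinuous_mult; auto. apply Ccontinuous_const. }
  apply holo_of_limit with (- (1) * p z * / (f z * f z))%C. intros e He.
  rewrite continuous_Cmod in Cq, Cf.
  specialize (Cq e He). apply locally_Cmod in Cq. destruct Cq as [d1 [Hd1 H1]].
  assert (Hpos : 0 < Cmod (f z)) by now apply Cmod_gt_0.
  specialize (Cf _ Hpos). apply locally_Cmod in Cf. destruct Cf as [d2 [Hd2 H2]].
  exists (Rmin d1 d2). split. now apply Rmin_pos. intros y Hy.
  specialize (H1 y (Rlt_le_trans _ _ _ Hy (Rmin_l _ _))).
  specialize (H2 y (Rlt_le_trans _ _ _ Hy (Rmin_r _ _))).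
  assert (Hfy : f y <> 0%C).
  { apply Cmod_gt_0. generalize (Cmod_triangle_minus (f z) (f y)).
    rewrite Cmod_minus_sym. lra. }
  replace (/ f y - / f z)%C with (- (f y - f z) * / (f y * f z))%C by (field; auto).
  rewrite Ep.
  replace (- (p y * (y - z)) * / (f y * f z) - - (1) * p z * / (f z * f z) * (y - z))%C
    with ((- (1) * p y * / (f y * f z) - - (1) * p z * / (f z * f z)) * (y - z))%C by ring.
  rewrite Cmod_mult. apply Rmult_le_compat_r. apply Cmod_ge_0. now left.
Qed.

(** * Compactness by bisection *)

Lemma pow2_half_pos (h : R) (k : nat) : 0 < h -> 0 < h / 2 ^ k.
Proof. intros H. apply Rdiv_lt_0_compat; auto. apply pow_lt. lra. Qed.

Lemma half_pow_S (h : R) (k : nat) : h / 2 ^ S k = h / 2 ^ k / 2.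
Proof. simpl. field. apply pow_nonzero. lra. Qed.

Lemma half_pow_small (h e : R) : 0 < h -> 0 < e -> exists k, h / 2 ^ k < e.
Proof.
  intros Hh He.
  destruct (Pow_x_infinity 2 ltac:(rewrite Rabs_pos_eq; lra) (h / e + 1)) as [k Hk].
  exists k. specialize (Hk k (Nat.le_refl _)).
  assert (Hp : 0 < 2 ^ k) by (apply pow_lt; lra).
  rewrite Rabs_pos_eq in Hk by lra.
  apply Rmult_lt_reg_r with (2 ^ k); auto.
  unfold Rdiv. rewrite Rmult_assoc, Rinv_l, Rmult_1_r by lra.
  assert (Hq : h = h / e * e) by (field; lra).
  rewrite Hq. rewrite Rmult_comm. apply Rmult_lt_compat_l; lra.
Qed.

Lemma nested_intervals (x : nat -> R) (h : R) :
  0 < h ->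
  (forall k, x k <= x (S k) /\ x (S k) + h / 2 ^ S k <= x k + h / 2 ^ k) ->
  exists X, forall k, x k <= X <= x k + h / 2 ^ k.
Proof.
  intros Hh Hx.
  assert (Hmono : forall k j, x k <= x (k + j)%nat /\
            x (k + j)%nat + h / 2 ^ (k + j) <= x k + h / 2 ^ k).
  { intros k j. induction j as [|j IH].
    - rewrite Nat.add_0_r. lra.
    - rewrite Nat.add_succ_r. specialize (Hx (k + j)%nat). lra. }
  assert (Hub : forall k j, x j <= x k + h / 2 ^ k).
  { intros k j. assert (P1 := pow2_half_pos h k Hh). assert (P2 := pow2_half_pos h j Hh).
    destruct (Nat.le_ge_cases k j) as [L|L].
    - destruct (Hmono k (j - k)%nat) as [_ B]. replace (k + (j - k))%nat with j in B by lia. lra.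
    - destruct (Hmono j (k - j)%nat) as [B _]. replace (j + (k - j))%nat with k in B by lia. lra. }
  destruct (completeness (fun r => exists k, r = x k)) as [X [HX1 HX2]].
  - exists (x 0%nat + h / 2 ^ 0). intros r [j ->]. apply Hub.
  - exists (x 0%nat), 0%nat. reflexivity.
  - exists X. intros k. split.
    + apply HX1. now exists k.
    + apply HX2. intros r [j ->]. apply Hub.
Qed.

(** A square violating [Q] has a quarter violating [Q]; the nested bad squares shrink to a point,
    where the local hypothesis is contradicted. This serves both for compactness of the disk and for
    Goursat's theorem. *)
Lemma square_bisection (Q : R -> R -> R -> Prop) (x0 y0 h0 : R) :
  0 < h0 ->
  (forall x y h, 0 < h -> Q x y (h / 2) -> Q (x + h / 2) y (h / 2) ->
     Q x (y + h / 2) (h / 2) -> Q (x + h / 2) (y + h / 2) (h / 2) -> Q x y h) ->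
  (forall X Y, x0 <= X <= x0 + h0 -> y0 <= Y <= y0 + h0 ->
     exists d, 0 < d /\ forall x y h, 0 < h < d ->
       x0 <= x -> x <= X <= x + h -> x + h <= x0 + h0 ->
       y0 <= y -> y <= Y <= y + h -> y + h <= y0 + h0 -> Q x y h) ->
  Q x0 y0 h0.
Proof.
  intros Hh0 Hsplit Hloc. apply NNPP. intros Hbad.
  set (good := fun (p : R * R) (h : R) (p' : R * R) =>
     ~ Q (fst p') (snd p') (h / 2) /\
     fst p <= fst p' /\ fst p' + h / 2 <= fst p + h /\
     snd p <= snd p' /\ snd p' + h / 2 <= snd p + h).
  assert (Hstep : forall p h, 0 < h -> ~ Q (fst p) (snd p) h -> exists p', good p h p').
  { intros [x y] h Hh HQ. apply NNPP. intros Hno. apply HQ.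
    apply Hsplit; auto; apply NNPP; intros HN; apply Hno.
    - exists (x, y). unfold good; simpl. repeat split; auto; lra.
    - exists (x + h / 2, y). unfold good; simpl. repeat split; auto; lra.
    - exists (x, y + h / 2). unfold good; simpl. repeat split; auto; lra.
    - exists (x + h / 2, y + h / 2). unfold good; simpl. repeat split; auto; lra. }
  (* Each corner is a choice of a bad quarter of the previous square. The default value of [epsilon]
     is never met, since [Hstep] provides such a quarter as long as the current square is bad. *)
  set (u := fix u (k : nat) : R * R :=
     match k with
     | O => (x0, y0)
     | S k' => epsilon (inhabits (0, 0)) (good (u k') (h0 / 2 ^ k'))
     end).
  assert (Hu : forall k, ~ Q (fst (u k)) (snd (u k)) (h0 / 2 ^ k)).
  { induction k as [|k IH].
    - simpl. replace (h0 / 1) with h0 by field. exact Hbad.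
    - assert (G : good (u k) (h0 / 2 ^ k) (u (S k))).
      { apply (epsilon_spec (inhabits (0, 0))). apply Hstep; auto. now apply pow2_half_pos. }
      rewrite half_pow_S. apply G. }
  assert (HG : forall k, good (u k) (h0 / 2 ^ k) (u (S k))).
  { intros k. apply (epsilon_spec (inhabits (0, 0))). apply Hstep; auto. now apply pow2_half_pos. }
  destruct (nested_intervals (fun k => fst (u k)) h0 Hh0) as [X HX].
  { intros k. destruct (HG k) as [_ [A [B _]]]. rewrite half_pow_S. lra. }
  destruct (nested_intervals (fun k => snd (u k)) h0 Hh0) as [Y HY].
  { intros k. destruct (HG k) as [_ [_ [_ [A B]]]]. rewrite half_pow_S. lra. }
  assert (Hin : forall k, x0 <= fst (u k) /\ fst (u k) + h0 / 2 ^ k <= x0 + h0 /\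
                          y0 <= snd (u k) /\ snd (u k) + h0 / 2 ^ k <= y0 + h0).
  { induction k as [|k IH].
    - simpl. replace (h0 / 1) with h0 by field. lra.
    - destruct (HG k) as [_ G]. rewrite half_pow_S. lra. }
  destruct (Hloc X Y) as [d [Hd HQ]].
  - specialize (HX 0%nat). simpl in HX. lra.
  - specialize (HY 0%nat). simpl in HY. lra.
  - destruct (half_pow_small h0 d Hh0 Hd) as [k Hk].
    apply (Hu k). destruct (Hin k) as [A1 [A2 [A3 A4]]].
    apply HQ; auto. split; auto. now apply pow2_half_pos.
Qed.

Lemma Cmod_le_coord (x y : R) : Cmod (x, y) <= Rabs x + Rabs y.
Proof.
  replace (x, y) with (RtoC x + RtoC y * Ci)%C.
  - apply Rle_trans with (1 := Cmod_triangle _ _).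
    rewrite Cmod_mult, !Cmod_R, Cmod_Ci. lra.
  - apply injective_projections; simpl; ring.
Qed.

(** Compactness in the form of a Lebesgue number: [P d z] gets weaker as [d] decreases, so finitely
    many local values of [d] can be replaced by their minimum. Boundedness, uniform continuity and
    the enlargement of the disk are all instances. *)
Lemma closed_disk_uniform (P : R -> C -> Prop) (r : R) :
  (forall d d' z, P d z -> d' <= d -> P d' z) ->
  (forall z, Cmod z <= r ->
     exists d, 0 < d /\ forall y, Cmod y <= r -> Cmod (y - z)%C < d -> P d y) ->
  exists d, 0 < d /\ forall z, Cmod z <= r -> P d z.
Proof.
  intros Hmono Hloc.
  destruct (Rlt_le_dec r 0) as [Hr|Hr].
  { exists 1. split. lra. intros z Hz. generalize (Cmod_ge_0 z). lra. }
  set (Q := fun x y h => exists d, 0 < d /\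
     forall z : C, x <= fst z <= x + h -> y <= snd z <= y + h -> Cmod z <= r -> P d z).
  (* This square contains the disk, and the extra 1 keeps its side positive when [r = 0]. *)
  assert (HQ : Q (- r - 1) (- r - 1) (2 * r + 2)).
  { apply square_bisection.
    - lra.
    - intros x y h Hh [d1 [P1 H1]] [d2 [P2 H2]] [d3 [P3 H3]] [d4 [P4 H4]].
      exists (Rmin (Rmin d1 d2) (Rmin d3 d4)). split. repeat apply Rmin_pos; auto.
      assert (M1 := Rmin_l (Rmin d1 d2) (Rmin d3 d4)).
      assert (M2 := Rmin_r (Rmin d1 d2) (Rmin d3 d4)).
      assert (M3 := Rmin_l d1 d2). assert (M4 := Rmin_r d1 d2).
      assert (M5 := Rmin_l d3 d4). assert (M6 := Rmin_r d3 d4).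
      intros z Hx Hy Hz.
      destruct (Rle_dec (fst z) (x + h / 2)), (Rle_dec (snd z) (y + h / 2)).
      + apply Hmono with d1; [apply H1; auto; lra|lra].
      + apply Hmono with d3; [apply H3; auto; lra|lra].
      + apply Hmono with d2; [apply H2; auto; lra|lra].
      + apply Hmono with d4; [apply H4; auto; lra|lra].
    - intros X Y HX HY. destruct (Rle_dec (Cmod (X, Y)) r) as [HR|HR].
      + destruct (Hloc _ HR) as [d [Hd H]]. exists (d / 2). split. lra.
        intros x y h [Hh1 Hh2] _ Hx _ _ Hy _. exists d. split; auto.
        intros [z1 z2] Hz1 Hz2 Hz. simpl in *. apply H; auto.
        replace ((z1, z2) - (X, Y))%C with ((z1 - X, z2 - Y) : C) by reflexivity.
        apply Rle_lt_trans with (1 := Cmod_le_coord _ _).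
        assert (Rabs (z1 - X) <= h) by (apply Rabs_le; lra).
        assert (Rabs (z2 - Y) <= h) by (apply Rabs_le; lra). lra.
      (* Around a point outside the disk, small squares miss the disk and the property is
         vacuous. *)
      + exists ((Cmod (X, Y) - r) / 2). split. lra.
        intros x y h [Hh1 Hh2] _ Hx _ _ Hy _. exists 1. split. lra.
        intros [z1 z2] Hz1 Hz2 Hz. simpl in *. exfalso.
        assert (A := Cmod_triangle_minus (X, Y) (z1, z2)).
        replace ((X, Y) - (z1, z2))%C with ((X - z1, Y - z2) : C) in A by reflexivity.
        assert (B := Cmod_le_coord (X - z1) (Y - z2)).
        assert (Rabs (X - z1) <= h) by (apply Rabs_le; lra).
        assert (Rabs (Y - z2) <= h) by (apply Rabs_le; lra). lra. }
  destruct HQ as [d [Hd H]]. exists d. split; auto. intros z Hz.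
  assert (A := Rmax_Cmod z).
  assert (B1 := Rle_trans _ _ _ (Rmax_l (Rabs (fst z)) (Rabs (snd z))) A).
  assert (B2 := Rle_trans _ _ _ (Rmax_r (Rabs (fst z)) (Rabs (snd z))) A).
  assert (B1' := Rle_trans _ _ _ B1 Hz). assert (B2' := Rle_trans _ _ _ B2 Hz).
  apply Rabs_le_between in B1'. apply Rabs_le_between in B2'.
  apply H; auto; lra.
Qed.

Lemma closed_disk_bounded (f : C -> C) (r : R) :
  (forall z, Cmod z <= r -> continuousC f z) ->
  exists K, 0 < K /\ forall z, Cmod z <= r -> Cmod (f z) <= K.
Proof.
  intros Hf.
  (* Here [d] is the reciprocal of a bound, so that smaller values are weaker. *)
  destruct (closed_disk_uniform (fun d z => Cmod (f z) * d <= 1) r) as [d [Hd H]].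
  - intros d d' z H1 H2. apply Rle_trans with (2 := H1).
    apply Rmult_le_compat_l; auto. apply Cmod_ge_0.
  - intros z Hz. specialize (Hf z Hz). rewrite continuous_Cmod in Hf.
    specialize (Hf 1 Rlt_0_1). apply locally_Cmod in Hf. destruct Hf as [d [Hd Hf]].
    assert (Hc := Cmod_ge_0 (f z)).
    assert (Hi : 0 < / (Cmod (f z) + 1)) by (apply Rinv_0_lt_compat; lra).
    exists (Rmin d (/ (Cmod (f z) + 1))). split. now apply Rmin_pos.
    intros y _ Hy. specialize (Hf y (Rlt_le_trans _ _ _ Hy (Rmin_l _ _))).
    assert (A := Cmod_triangle_minus (f y) (f z)).
    apply Rle_trans with ((Cmod (f z) + 1) * / (Cmod (f z) + 1)).
    + apply Rmult_le_compat.
      * apply Cmod_ge_0.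
      * apply Rlt_le, Rmin_pos; auto.
      * lra.
      * apply Rmin_r.
    + rewrite Rinv_r; lra.
  - exists (/ d). split. now apply Rinv_0_lt_compat. intros z Hz.
    apply Rmult_le_reg_r with d; auto. rewrite Rinv_l by lra. auto.
Qed.

Lemma closed_disk_lt_1 (f : C -> C) (r : R) :
  (forall z, Cmod z <= r -> continuousC f z) ->
  (forall z, Cmod z <= r -> Cmod (f z) < 1) ->
  exists M, 0 < M < 1 /\ forall z, Cmod z <= r -> Cmod (f z) <= M.
Proof.
  intros Hf H1.
  destruct (closed_disk_uniform (fun d z => Cmod (f z) <= 1 - d) r) as [d [Hd H]].
  - intros d d' z A B. lra.
  - intros z Hz. specialize (Hf z Hz). specialize (H1 z Hz).
    rewrite continuous_Cmod in Hf.
    set (e := (1 - Cmod (f z)) / 2). assert (He : 0 < e) by (unfold e; lra).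
    specialize (Hf e He). apply locally_Cmod in Hf. destruct Hf as [d [Hd Hf]].
    exists (Rmin d e). split. now apply Rmin_pos.
    intros y _ Hy. specialize (Hf y (Rlt_le_trans _ _ _ Hy (Rmin_l _ _))).
    assert (A := Cmod_triangle_minus (f y) (f z)). assert (B := Rmin_r d e).
    unfold e in *. lra.
  (* The cut at [1 / 2] keeps the bound positive. *)
  - exists (1 - Rmin d (1 / 2)). assert (A := Rmin_l d (1 / 2)). assert (B := Rmin_r d (1/2)).
    assert (0 < Rmin d (1 / 2)) by (apply Rmin_pos; lra). split. lra.
    intros z Hz. specialize (H z Hz). lra.
Qed.

Lemma closed_disk_unif_continuous (f : C -> C) (r e : R) :
  (forall z, Cmod z <= r -> continuousC f z) -> 0 < e ->
  exists d, 0 < d /\ forall z y, Cmod z <= r -> Cmod y <= r -> Cmod (y - z)%C < d ->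
    Cmod (f y - f z)%C < e.
Proof.
  intros Hf He.
  destruct (closed_disk_uniform
     (fun d z => forall y, Cmod y <= r -> Cmod (y - z)%C < d -> Cmod (f y - f z)%C < e) r) as [d [Hd H]].
  - intros d d' z A B y Hy Hyz. apply A; auto. lra.
  - intros z Hz. specialize (Hf z Hz). rewrite continuous_Cmod in Hf.
    assert (He2 : 0 < e / 2) by lra.
    specialize (Hf _ He2). apply locally_Cmod in Hf. destruct Hf as [d [Hd Hf]].
    exists (d / 2). split. lra. intros y Hy Hyz w Hw Hwy.
    replace (f w - f y)%C with ((f w - f z) + (f z - f y))%C by ring.
    apply Rle_lt_trans with (1 := Cmod_triangle _ _).
    assert (A1 : Cmod (f y - f z)%C < e / 2) by (apply Hf; lra).
    assert (A2 : Cmod (f w - f z)%C < e / 2).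
    { apply Hf. replace (w - z)%C with ((w - y) + (y - z))%C by ring.
      apply Rle_lt_trans with (1 := Cmod_triangle _ _). lra. }
    rewrite (Cmod_minus_sym (f z)). lra.
  - exists d. split; auto.
Qed.

Lemma closed_disk_enlarge (U : C -> Prop) :
  @open C_UniformSpace U -> (forall z, Cmod z <= 1 -> U z) ->
  exists R1, 1 < R1 /\ forall z, Cmod z <= R1 -> U z.
Proof.
  intros HU H1.
  destruct (closed_disk_uniform (fun d z => forall y, Cmod (y - z)%C < d -> U y) 1) as [d [Hd H]].
  - intros d d' z A B y Hy. apply A. lra.
  - intros z Hz. destruct (proj1 (locally_Cmod z U) (HU z (H1 z Hz))) as [d [Hd A]].
    exists (d / 2). split. lra. intros y _ Hy w Hw. apply A.
    replace (w - z)%C with ((w - y) + (y - z))%C by ring.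
    apply Rle_lt_trans with (1 := Cmod_triangle _ _). lra.
  - exists (1 + d / 2). split. lra. intros z Hz.
    destruct (Rle_dec (Cmod z) 1) as [L|L]. auto.
    assert (Hc : Cmod z <> 0) by lra.
    (* A point outside the unit disk is compared with its radial projection on the circle, at
       distance [Cmod z - 1]. *)
    apply (H (RtoC (/ Cmod z) * z)%C).
    + rewrite Cmod_mult, Cmod_R, Rabs_pos_eq.
      * rewrite Rinv_l; lra.
      * left. apply Rinv_0_lt_compat. lra.
    + replace (z - RtoC (/ Cmod z) * z)%C with (RtoC (1 - / Cmod z) * z)%C
        by (rewrite RtoC_minus; ring).
      rewrite Cmod_mult, Cmod_R, Rabs_pos_eq.
      * replace ((1 - / Cmod z) * Cmod z) with (Cmod z - 1) by (field; auto). lra.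
      * assert (/ Cmod z <= / 1) by (apply Rinv_le_contravar; lra). rewrite Rinv_1 in H0. lra.
Qed.

(** * Goursat's theorem in polar coordinates *)

Notation continuousRC := (@continuous R_UniformSpace C_UniformSpace).
Notation ex_CInt := (@ex_RInt C_R_NormedModule).

Definition CInt (f : R -> C) (a b : R) : C := @RInt C_R_CompleteNormedModule f a b.

Lemma norm_C_R (z : C) : @norm R_AbsRing C_R_NormedModule z = Cmod z.
Proof.
  unfold norm; simpl. unfold prod_norm, Cmod. f_equal.
  unfold norm; simpl. unfold abs; simpl. rewrite !Rmult_1_r.
  f_equal; symmetry; apply Rsqr_abs.
Qed.

Lemma ex_CInt_continuous (f : R -> C) (a b : R) :
  a <= b -> (forall x, a <= x <= b -> continuousRC f x) -> ex_CInt f a b.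
Proof.
  intros Hab H. apply (@ex_RInt_continuous C_R_CompleteNormedModule).
  rewrite Rmin_left, Rmax_right by auto. exact H.
Qed.

Lemma CInt_correct (f : R -> C) (a b : R) :
  ex_CInt f a b -> @is_RInt C_R_NormedModule f a b (CInt f a b).
Proof. apply (@RInt_correct C_R_CompleteNormedModule). Qed.

Lemma CInt_unique (f : R -> C) (a b : R) (l : C) :
  @is_RInt C_R_NormedModule f a b l -> CInt f a b = l.
Proof. apply (@is_RInt_unique C_R_CompleteNormedModule). Qed.

Lemma CInt_ext (f g : R -> C) (a b : R) :
  a <= b -> (forall x, a < x < b -> f x = g x) -> CInt f a b = CInt g a b.
Proof.
  intros Hab H. apply (@RInt_ext C_R_CompleteNormedModule).
  rewrite Rmin_left, Rmax_right by auto. exact H.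
Qed.

Lemma CInt_plus (f g : R -> C) (a b : R) :
  ex_CInt f a b -> ex_CInt g a b ->
  CInt (fun x => (f x + g x)%C) a b = (CInt f a b + CInt g a b)%C.
Proof. exact (@RInt_plus C_R_CompleteNormedModule f g a b). Qed.

Lemma CInt_minus (f g : R -> C) (a b : R) :
  ex_CInt f a b -> ex_CInt g a b ->
  CInt (fun x => (f x - g x)%C) a b = (CInt f a b - CInt g a b)%C.
Proof. exact (@RInt_minus C_R_CompleteNormedModule f g a b). Qed.

Lemma CInt_Chasles (f : R -> C) (a b c : R) :
  ex_CInt f a b -> ex_CInt f b c -> CInt f a c = (CInt f a b + CInt f b c)%C.
Proof. intros H1 H2. symmetry. exact (@RInt_Chasles C_R_CompleteNormedModule f a b c H1 H2). Qed.

Lemma CInt_const (c : C) (a b : R) : CInt (fun _ => c) a b = (RtoC (b - a) * c)%C.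
Proof.
  unfold CInt. rewrite (@RInt_const C_R_CompleteNormedModule).
  apply (scal_R_Cmult (b - a) c).
Qed.

Lemma is_RInt_Re (f : R -> C) (a b : R) (l : C) :
  @is_RInt C_R_NormedModule f a b l -> is_RInt (fun t => Re (f t)) a b (Re l).
Proof. apply (@is_RInt_fct_extend_fst R_NormedModule R_NormedModule). Qed.

Lemma is_RInt_Im (f : R -> C) (a b : R) (l : C) :
  @is_RInt C_R_NormedModule f a b l -> is_RInt (fun t => Im (f t)) a b (Im l).
Proof. apply (@is_RInt_fct_extend_snd R_NormedModule R_NormedModule). Qed.

(** The integral is linear over the reals by construction; a complex factor has to be moved out
    through real and imaginary parts. *)
Lemma CInt_scal (c : C) (f : R -> C) (a b : R) :
  ex_CInt f a b -> CInt (fun x => (c * f x)%C) a b = (c * CInt f a b)%C.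
Proof.
  intros H. apply CInt_correct in H. apply CInt_unique.
  assert (HR := is_RInt_Re _ _ _ _ H). assert (HI := is_RInt_Im _ _ _ _ H).
  apply (@is_RInt_fct_extend_pair R_NormedModule R_NormedModule).
  - exact (is_RInt_minus _ _ a b _ _ (is_RInt_scal _ a b (Re c) _ HR) (is_RInt_scal _ a b (Im c) _ HI)).
  - exact (is_RInt_plus _ _ a b _ _ (is_RInt_scal _ a b (Re c) _ HI) (is_RInt_scal _ a b (Im c) _ HR)).
Qed.

Lemma CInt_bound (f : R -> C) (a b M : R) :
  a <= b -> ex_CInt f a b -> (forall x, a <= x <= b -> Cmod (f x) <= M) ->
  Cmod (CInt f a b) <= (b - a) * M.
Proof.
  intros Hab Hf HM. rewrite <- norm_C_R.
  apply (@norm_RInt_le_const C_R_NormedModule f); auto.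
  - intros x Hx. rewrite norm_C_R. auto.
  - now apply CInt_correct.
Qed.

Definition cis (t : R) : C := (cos t, sin t).

Lemma cis_0 : cis 0 = 1%C.
Proof. unfold cis. now rewrite cos_0, sin_0. Qed.

Lemma cis_2PI : cis (2 * PI) = 1%C.
Proof. unfold cis. now rewrite cos_2PI, sin_2PI. Qed.

Lemma Cmod_cis (t : R) : Cmod (cis t) = 1.
Proof.
  unfold Cmod, cis; simpl. rewrite !Rmult_1_r.
  rewrite Rplus_comm. generalize (sin2_cos2 t). unfold Rsqr. intros ->. apply sqrt_1.
Qed.

Lemma continuous_cis (t : R) : continuousRC cis t.
Proof.
  apply continuous_pairC.
  - apply continuity_pt_filterlim, continuity_cos.
  - apply continuity_pt_filterlim, continuity_sin.
Qed.

Lemma is_RInt_cis (a b : R) :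
  @is_RInt C_R_NormedModule (fun t => (Ci * cis t)%C) a b (cis b - cis a)%C.
Proof.
  apply (@is_RInt_fct_extend_pair R_NormedModule R_NormedModule).
  - apply is_RInt_ext with (fun t => - sin t).
    { intros x _. unfold cis; simpl. ring. }
    apply (is_RInt_derive cos).
    + intros x _. apply is_derive_cos.
    + intros x _. apply (@continuous_opp R_UniformSpace R_AbsRing R_NormedModule).
      apply continuity_pt_filterlim, continuity_sin.
  - apply is_RInt_ext with cos.
    { intros x _. unfold cis; simpl. ring. }
    apply (is_RInt_derive sin).
    + intros x _. apply is_derive_sin.
    + intros x _. apply continuity_pt_filterlim, continuity_cos.
Qed.

Lemma CInt_cis (a b : R) : CInt cis a b = (- Ci * (cis b - cis a))%C.
Proof.
  assert (E : ex_CInt (fun t => (Ci * cis t)%C) a b) by (eexists; apply is_RInt_cis).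
  rewrite <- (CInt_unique _ _ _ _ (is_RInt_cis a b)), <- CInt_scal by auto.
  unfold CInt. apply (@RInt_ext C_R_CompleteNormedModule). intros x _.
  apply injective_projections; simpl; ring.
Qed.

(** The derivative [Ci * cis t] has modulus 1, so a chord is at most as long as its arc. *)
Lemma cis_lipschitz (a b : R) : Cmod (cis b - cis a)%C <= Rabs (b - a).
Proof.
  rewrite <- norm_C_R. rewrite <- (Rmult_1_r (Rabs _)).
  apply (@norm_RInt_le_const_abs C_R_NormedModule (fun t => (Ci * cis t)%C)).
  - intros x _. rewrite norm_C_R, Cmod_mult, Cmod_Ci, Cmod_cis. lra.
  - apply is_RInt_cis.
Qed.

Lemma Cmod_polar (s t : R) : 0 <= s -> Cmod (RtoC s * cis t)%C = s.
Proof. intros Hs. rewrite Cmod_mult, Cmod_R, Cmod_cis, Rabs_pos_eq; lra. Qed.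

Lemma continuous_RtoC (s : R) : continuousRC RtoC s.
Proof. apply continuous_pairC. apply continuous_id. apply continuous_const. Qed.

(** * Boundary integrals of polar rectangles *)

Definition arc_int (f : C -> C) (s t1 t2 : R) : C :=
  CInt (fun t => f (RtoC s * cis t)%C) t1 t2.

(** With [z = s * cis t], the form dz / (i z) is dt along an arc and -i ds / s along a ray. *)
Definition ray_int (f : C -> C) (t s1 s2 : R) : C :=
  CInt (fun s => (- Ci * / RtoC s * f (RtoC s * cis t))%C) s1 s2.

(* The integral of f(z) dz / (i z) along the boundary of a polar rectangle. *)
Definition polar_int (f : C -> C) (s1 s2 t1 t2 : R) : C :=
  (arc_int f s2 t1 t2 - arc_int f s1 t1 t2 - ray_int f t2 s1 s2 + ray_int f t1 s1 s2)%C.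

Lemma ex_arc_int (f : C -> C) (s t1 t2 : R) :
  0 <= s -> t1 <= t2 -> (forall z, Cmod z = s -> continuousC f z) ->
  ex_CInt (fun t => f (RtoC s * cis t)%C) t1 t2.
Proof.
  intros Hs Ht Hf. apply ex_CInt_continuous; auto. intros t _.
  apply (continuous_comp (fun t => (RtoC s * cis t)%C : C_UniformSpace) f).
  - apply Ccontinuous_mult. apply Ccontinuous_const. apply continuous_cis.
  - apply Hf. now apply Cmod_polar.
Qed.

Lemma RtoC_neq_0 (s : R) : 0 < s -> RtoC s <> 0%C.
Proof. intros Hs H. apply RtoC_inj in H. lra. Qed.

Lemma ex_ray_int (f : C -> C) (t s1 s2 : R) :
  0 < s1 -> s1 <= s2 -> (forall z, s1 <= Cmod z <= s2 -> continuousC f z) ->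
  ex_CInt (fun s => (- Ci * / RtoC s * f (RtoC s * cis t))%C) s1 s2.
Proof.
  intros Hs Hs2 Hf. apply ex_CInt_continuous; auto. intros s Hx.
  apply Ccontinuous_mult. apply Ccontinuous_mult.
  - apply Ccontinuous_const.
  - apply Ccontinuous_inv. apply RtoC_neq_0; lra. apply continuous_RtoC.
  - apply (continuous_comp (fun s => (RtoC s * cis t)%C : C_UniformSpace) f).
    + apply Ccontinuous_mult. apply continuous_RtoC. apply Ccontinuous_const.
    + apply Hf. rewrite Cmod_polar; lra.
Qed.

(** Each inner side belongs to two adjacent pieces with opposite orientations, so it cancels. *)
Lemma polar_int_quarter (f : C -> C) (s1 s2 s3 t1 t2 t3 : R) :
  0 < s1 -> s1 <= s2 <= s3 -> t1 <= t2 <= t3 ->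
  (forall z, s1 <= Cmod z <= s3 -> continuousC f z) ->
  polar_int f s1 s3 t1 t3 =
  (polar_int f s1 s2 t1 t2 + polar_int f s2 s3 t1 t2 +
   polar_int f s1 s2 t2 t3 + polar_int f s2 s3 t2 t3)%C.
Proof.
  intros H1 [H2 H3] [H4 H5] Hf.
  assert (HT : forall s, s1 <= s <= s3 ->
     arc_int f s t1 t3 = (arc_int f s t1 t2 + arc_int f s t2 t3)%C).
  { intros s Hs. apply CInt_Chasles; apply ex_arc_int; try lra;
      intros z Hz; apply Hf; lra. }
  assert (HS : forall t, ray_int f t s1 s3 = (ray_int f t s1 s2 + ray_int f t s2 s3)%C).
  { intros t. apply CInt_Chasles; apply ex_ray_int; try lra; intros z Hz; apply Hf; lra. }
  unfold polar_int. rewrite !HS, !HT by lra. ring.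
Qed.

Lemma polar_int_minus (f g : C -> C) (s1 s2 t1 t2 : R) :
  0 < s1 -> s1 <= s2 -> t1 <= t2 ->
  (forall z, s1 <= Cmod z <= s2 -> continuousC f z) ->
  (forall z, s1 <= Cmod z <= s2 -> continuousC g z) ->
  polar_int (fun z => (f z - g z)%C) s1 s2 t1 t2 =
  (polar_int f s1 s2 t1 t2 - polar_int g s1 s2 t1 t2)%C.
Proof.
  intros H1 H2 H3 Hf Hg.
  assert (HT : forall s, s1 <= s <= s2 ->
     arc_int (fun z => (f z - g z)%C) s t1 t2 = (arc_int f s t1 t2 - arc_int g s t1 t2)%C).
  { intros s Hs.
    apply (CInt_minus (fun t => f (RtoC s * cis t)%C) (fun t => g (RtoC s * cis t)%C));
      apply ex_arc_int; try lra; intros z Hz; try apply Hf; try apply Hg; lra. }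
  assert (HS : forall t, ray_int (fun z => (f z - g z)%C) t s1 s2 = (ray_int f t s1 s2 - ray_int g t s1 s2)%C).
  { intros t. unfold ray_int.
    rewrite <- CInt_minus by (apply ex_ray_int; auto).
    apply CInt_ext; auto. intros; ring. }
  unfold polar_int. rewrite !HS, !HT by lra. ring.
Qed.

(** The term [B * z] cancels the pole of the form and leaves an integrand with a primitive. For the
    constant [A], the two arcs contribute the same value with opposite signs, and so do the two
    rays. *)
Lemma polar_int_affine (A B : C) (s1 s2 t1 t2 : R) :
  0 < s1 -> s1 <= s2 -> t1 <= t2 ->
  polar_int (fun z => (A + B * z)%C) s1 s2 t1 t2 = 0%C.
Proof.
  intros H1 H2 H3.
  assert (Ecis : forall a b, a <= b -> ex_CInt cis a b).
  { intros a b Hab. apply ex_CInt_continuous; auto. intros; apply continuous_cis. }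
  assert (Econst : forall c a b, ex_CInt (fun _ => c) a b) by (intros; apply ex_RInt_const).
  assert (HT : forall s, arc_int (fun z => (A + B * z)%C) s t1 t2 =
    (RtoC (t2 - t1) * A + B * RtoC s * (- Ci * (cis t2 - cis t1)))%C).
  { intros s. unfold arc_int. rewrite <- CInt_cis, <- CInt_scal, <- CInt_const, <- CInt_plus; auto.
    - apply CInt_ext; auto. intros; ring.
    - apply ex_CInt_continuous; auto. intros.
      apply Ccontinuous_mult. apply Ccontinuous_const. apply continuous_cis. }
  assert (Einv : ex_CInt (fun s => (/ RtoC s)%C) s1 s2).
  { apply ex_CInt_continuous; auto. intros. apply Ccontinuous_inv.
    apply RtoC_neq_0; lra. apply continuous_RtoC. }
  assert (HS : forall t, ray_int (fun z => (A + B * z)%C) t s1 s2 =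
    (- Ci * A * CInt (fun s => (/ RtoC s)%C) s1 s2 + RtoC (s2 - s1) * (- Ci * B * cis t))%C).
  { intros t. unfold ray_int. rewrite <- CInt_const, <- CInt_scal, <- CInt_plus; auto.
    - apply CInt_ext; auto. intros x Hx. field. apply RtoC_neq_0; lra.
    - apply ex_CInt_continuous; auto. intros.
      apply Ccontinuous_mult. apply Ccontinuous_const. apply Ccontinuous_inv.
      apply RtoC_neq_0; lra. apply continuous_RtoC. }
  unfold polar_int. rewrite !HS, !HT. rewrite !RtoC_minus. ring.
Qed.

Lemma polar_int_bound (f : C -> C) (s1 s2 t1 t2 M : R) :
  0 < s1 -> s1 <= s2 -> t1 <= t2 ->
  (forall z, s1 <= Cmod z <= s2 -> continuousC f z) ->
  (forall s t, s1 <= s <= s2 -> t1 <= t <= t2 -> Cmod (f (RtoC s * cis t)%C) <= M) ->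
  Cmod (polar_int f s1 s2 t1 t2) <= 2 * M * ((t2 - t1) + (s2 - s1) / s1).
Proof.
  intros H1 H2 H3 Hf HM.
  assert (HT : forall s, s1 <= s <= s2 -> Cmod (arc_int f s t1 t2) <= (t2 - t1) * M).
  { intros s Hs. apply CInt_bound; auto. apply ex_arc_int; try lra. intros; apply Hf; lra. }
  assert (HS : forall t, t1 <= t <= t2 -> Cmod (ray_int f t s1 s2) <= (s2 - s1) * (/ s1 * M)).
  { intros t Ht. apply CInt_bound; auto. now apply ex_ray_int.
    intros s Hs. rewrite !Cmod_mult, Cmod_opp, Cmod_Ci, Rmult_1_l, Cmod_inv by (apply RtoC_neq_0; lra).
    rewrite Cmod_R, Rabs_pos_eq by lra.
    apply Rmult_le_compat; auto.
    - left. apply Rinv_0_lt_compat. lra.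
    - apply Cmod_ge_0.
    - apply Rinv_le_contravar; lra. }
  unfold polar_int.
  apply Rle_trans with (Cmod (arc_int f s2 t1 t2) + Cmod (arc_int f s1 t1 t2)
      + Cmod (ray_int f t2 s1 s2) + Cmod (ray_int f t1 s1 s2)).
  - unfold Cminus. eapply Rle_trans. apply Cmod_triangle. apply Rplus_le_compat_r.
    eapply Rle_trans. apply Cmod_triangle. rewrite Cmod_opp. apply Rplus_le_compat_r.
    eapply Rle_trans. apply Cmod_triangle. rewrite Cmod_opp. lra.
  - assert (A1 := HT s1 ltac:(lra)). assert (A2 := HT s2 ltac:(lra)).
    assert (A3 := HS t1 ltac:(lra)). assert (A4 := HS t2 ltac:(lra)).
    unfold Rdiv. replace ((s2 - s1) * (/ s1 * M)) with ((s2 - s1) * / s1 * M) in * by ring. lra.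
Qed.

(** Goursat's local estimate: the affine approximation of [f] at the point integrates to 0, and the
    remainder is small compared with the diameter. The bound is thus [e] times diameter times
    perimeter, the perimeter being measured by dz / z. *)
Lemma polar_int_local (f : C -> C) (a b s t e : R) :
  0 < a -> a <= b -> (forall z, a <= Cmod z <= b -> continuousC f z) ->
  a <= s <= b -> holo f (RtoC s * cis t)%C -> 0 < e ->
  exists d, 0 < d /\ forall s1 s2 t1 t2,
    a <= s1 -> s1 <= s <= s2 -> s2 <= b -> t1 <= t <= t2 ->
    (s2 - s1) + b * (t2 - t1) < d ->
    Cmod (polar_int f s1 s2 t1 t2) <=
      e * ((s2 - s1) + b * (t2 - t1)) * ((t2 - t1) + (s2 - s1) / a).
Proof.
  intros Ha Hab Hf Hs Hh He.
  destruct (holo_limit _ _ Hh) as [l Hl].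
  set (z0 := (RtoC s * cis t)%C) in *.
  destruct (Hl (e / 2)) as [d [Hd H]]; [lra|].
  exists d. split; auto. intros s1 s2 t1 t2 H1 H2 H3 H4 H5.
  set (lin := fun z => ((f z0 - l * z0) + l * z)%C).
  assert (Clin : forall z, continuousC lin z).
  { intros z. apply Ccontinuous_plus. apply Ccontinuous_const.
    apply Ccontinuous_mult. apply Ccontinuous_const. apply continuous_id. }
  assert (E : polar_int f s1 s2 t1 t2 = polar_int (fun z => (f z - lin z)%C) s1 s2 t1 t2).
  { rewrite polar_int_minus; auto; try lra.
    - unfold lin at 1. rewrite polar_int_affine by lra. ring.
    - intros z Hz. apply Hf. lra. }
  rewrite E. set (rho := s2 - s1 + b * (t2 - t1)) in *.
  assert (Hrho : 0 <= rho).
  { unfold rho. assert (0 <= b * (t2 - t1)) by (apply Rmult_le_pos; lra). lra. }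
  eapply Rle_trans.
  - apply polar_int_bound with (M := e / 2 * rho); try lra.
    + intros z Hz. apply Ccontinuous_minus; auto. apply Hf. lra.
    + intros s' t' Hs' Ht'. set (y := (RtoC s' * cis t')%C).
      assert (Hy : Cmod (y - z0)%C <= rho).
      { unfold y, z0.
        replace (RtoC s' * cis t' - RtoC s * cis t)%C
          with (RtoC (s' - s) * cis t' + RtoC s * (cis t' - cis t))%C
          by (rewrite RtoC_minus; ring).
        eapply Rle_trans. apply Cmod_triangle.
        rewrite !Cmod_mult, !Cmod_R, Cmod_cis, Rmult_1_r, (Rabs_pos_eq s) by lra.
        unfold rho. apply Rplus_le_compat.
        - apply Rabs_le. lra.
        - apply Rmult_le_compat; try lra. apply Cmod_ge_0.
          eapply Rle_trans. apply cis_lipschitz. apply Rabs_le. lra. }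
      replace (f y - lin y)%C with (f y - f z0 - l * (y - z0))%C by (unfold lin; ring).
      eapply Rle_trans. apply H. lra.
      apply Rmult_le_compat_l; lra.
  - replace (2 * (e / 2 * rho)) with (e * rho) by field.
    apply Rmult_le_compat_l. apply Rmult_le_pos; lra.
    apply Rplus_le_compat_l. apply Rmult_le_compat_l. lra.
    apply Rinv_le_contravar; lra.
Qed.

(* Goursat's bisection argument, run in polar coordinates. *)
Lemma polar_int_zero (f : C -> C) (a b : R) :
  0 < a -> a < b -> (forall z, a <= Cmod z <= b -> holo f z) ->
  polar_int f a b 0 (2 * PI) = 0%C.
Proof.
  intros Ha Hab Hf.
  assert (Hc : forall z, a <= Cmod z <= b -> continuousC f z) by (intros; apply holo_continuous; auto).
  assert (HPI := PI_RGT_0).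
  set (L := b - a). set (w := 2 * PI).
  (* The annulus is parametrised by the unit square. A bound proportional to the area [h * h] is
     additive over the four quarters. *)
  set (Q := fun e x y h =>
     0 <= x -> x + h <= 1 -> 0 <= y -> y + h <= 1 ->
     Cmod (polar_int f (a + L * x) (a + L * (x + h)) (w * y) (w * (y + h))) <= e * (h * h)).
  assert (HL : 0 < L) by (unfold L; lra). assert (Hw : 0 < w) by (unfold w; lra).
  assert (HQ : forall e, 0 < e -> Q e 0 0 1).
  { intros e He. apply square_bisection.
    - lra.
    - intros x y h Hh Q1 Q2 Q3 Q4 Hx1 Hx2 Hy1 Hy2.
      assert (P : forall u v, 0 <= u <= v -> L * u <= L * v) by (intros; apply Rmult_le_compat_l; lra).
      assert (P' : forall u v, 0 <= u <= v -> w * u <= w * v) by (intros; apply Rmult_le_compat_l; lra).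
      specialize (Q1 ltac:(lra) ltac:(lra) ltac:(lra) ltac:(lra)).
      specialize (Q2 ltac:(lra) ltac:(lra) ltac:(lra) ltac:(lra)).
      specialize (Q3 ltac:(lra) ltac:(lra) ltac:(lra) ltac:(lra)).
      specialize (Q4 ltac:(lra) ltac:(lra) ltac:(lra) ltac:(lra)).
      replace (x + h / 2 + h / 2) with (x + h) in * by field.
      replace (y + h / 2 + h / 2) with (y + h) in * by field.
      assert (X0 := P 0 x ltac:(lra)). assert (X1 := P x (x + h / 2) ltac:(lra)).
      assert (X2 := P (x + h / 2) (x + h) ltac:(lra)). assert (X3 := P (x + h) 1 ltac:(lra)).
      rewrite (polar_int_quarter f _ (a + L * (x + h / 2)) _ _ (w * (y + h / 2))).
      + repeat (eapply Rle_trans; [apply Cmod_triangle|]).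
        eapply Rle_trans. apply Rplus_le_compat_r. apply Cmod_triangle.
        eapply Rle_trans. do 2 apply Rplus_le_compat_r. apply Cmod_triangle.
        lra.
      + lra.
      + lra.
      + split; apply P'; lra.
      + intros z Hz. apply Hc. unfold L in *. lra.
    - intros X Y HX HY.
      (* On a square of side [h], the diameter term is [A * h] and the perimeter term at most
         [B * h], so the local error [e / (A * B)] produces exactly [e * (h * h)]. *)
      set (A := L + b * w). set (B := w + L / a).
      assert (HA : 0 < A) by (unfold A; assert (0 < b * w) by (apply Rmult_lt_0_compat; lra); lra).
      assert (HB : 0 < B) by (unfold B; assert (0 < L / a) by (apply Rdiv_lt_0_compat; lra); lra).
      assert (HX1 : a <= a + L * X <= b).
      { assert (0 <= L * X) by (apply Rmult_le_pos; lra).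
        assert (L * X <= L * 1) by (apply Rmult_le_compat_l; lra). unfold L in *. lra. }
      destruct (polar_int_local f a b (a + L * X) (w * Y) (e / (A * B))) as [d [Hd H]];
        auto; try lra.
      { apply Hf. rewrite Cmod_polar; lra. }
      { apply Rdiv_lt_0_compat; auto. now apply Rmult_lt_0_compat. }
      exists (d / A). split. now apply Rdiv_lt_0_compat.
      intros x y h [Hh1 Hh2] Hx1 Hx2 Hx3 Hy1 Hy2 Hy3 _ _ _ _.
      assert (P : forall u v, u <= v -> L * u <= L * v) by (intros; apply Rmult_le_compat_l; lra).
      assert (P' : forall u v, u <= v -> w * u <= w * v) by (intros; apply Rmult_le_compat_l; lra).
      assert (E1 : a + L * (x + h) - (a + L * x) = L * h) by ring.
      assert (E2 : w * (y + h) - w * y = w * h) by ring.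
      assert (Hd2 : A * h < d).
      { replace d with (A * (d / A)) by (field; lra). apply Rmult_lt_compat_l; auto. }
      eapply Rle_trans. apply H.
      + assert (0 <= L * x) by (apply Rmult_le_pos; lra). lra.
      + assert (P1 := P x X ltac:(lra)). assert (P2 := P X (x + h) ltac:(lra)). lra.
      + assert (P1 := P (x + h) 1 ltac:(lra)). unfold L in *; lra.
      + split; apply P'; lra.
      + rewrite E1, E2. unfold A in Hd2. lra.
      + rewrite E1, E2. right.
        replace (L * h + b * (w * h)) with (A * h) by (unfold A; ring).
        replace (w * h + L * h / a) with (B * h) by (unfold B; field; lra).
        field. split; lra. }
  apply Cmod_eq_0. apply Rle_antisym; [|apply Cmod_ge_0].
  apply le_epsilon. intros e He.
  specialize (HQ e He ltac:(lra) ltac:(lra) ltac:(lra) ltac:(lra)).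
  replace (a + L * 0) with a in HQ by ring.
  replace (a + L * (0 + 1)) with b in HQ by (unfold L; ring).
  replace (w * 0) with 0 in HQ by ring. replace (w * (0 + 1)) with (2 * PI) in HQ by (unfold w; ring).
  fold w in HQ. lra.
Qed.

(** After a full turn the two rays coincide and cancel, leaving the two circles. *)
Lemma arc_int_annulus (f : C -> C) (a b : R) :
  0 < a -> a <= b -> (forall z, a <= Cmod z <= b -> holo f z) ->
  arc_int f a 0 (2 * PI) = arc_int f b 0 (2 * PI).
Proof.
  intros Ha [Hab| ->] Hf; [|reflexivity].
  assert (H := polar_int_zero f a b Ha Hab Hf). unfold polar_int in H.
  assert (E : ray_int f (2 * PI) a b = ray_int f 0 a b).
  { unfold ray_int. now rewrite cis_2PI, cis_0. }
  rewrite E in H.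
  replace (arc_int f b 0 (2 * PI)) with
    (arc_int f a 0 (2 * PI) + (arc_int f b 0 (2 * PI) - arc_int f a 0 (2 * PI) -
      ray_int f 0 a b + ray_int f 0 a b))%C by ring.
  rewrite H. ring.
Qed.

(** * Cauchy's formula and Taylor coefficients *)

Definition circle_mean (f : C -> C) (s : R) : C :=
  (RtoC (/ (2 * PI)) * arc_int f s 0 (2 * PI))%C.

Definition circle_continuous (f : C -> C) (s : R) : Prop :=
  forall z, Cmod z = s -> continuousC f z.

Lemma two_PI_pos : 0 < 2 * PI.
Proof. generalize PI_RGT_0. lra. Qed.

Lemma circle_mean_const (c : C) (s : R) : circle_mean (fun _ => c) s = c.
Proof.
  unfold circle_mean, arc_int. rewrite CInt_const, Cmult_assoc, <- RtoC_mult.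
  replace (/ (2 * PI) * (2 * PI - 0)) with 1 by (field; generalize PI_RGT_0; lra).
  ring.
Qed.

Lemma circle_mean_ext (f g : C -> C) (s : R) :
  0 <= s -> (forall z, Cmod z = s -> f z = g z) -> circle_mean f s = circle_mean g s.
Proof.
  intros Hs H. unfold circle_mean, arc_int. f_equal. apply CInt_ext.
  - left; apply two_PI_pos.
  - intros t _. apply H. now apply Cmod_polar.
Qed.

Lemma circle_mean_plus (f g : C -> C) (s : R) :
  0 <= s -> circle_continuous f s -> circle_continuous g s ->
  circle_mean (fun z => (f z + g z)%C) s = (circle_mean f s + circle_mean g s)%C.
Proof.
  intros Hs Hf Hg. unfold circle_mean, arc_int. assert (P := two_PI_pos).
  rewrite (CInt_plus (fun t => f (RtoC s * cis t)%C) (fun t => g (RtoC s * cis t)%C)).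
  - ring.
  - apply ex_arc_int; auto; lra.
  - apply ex_arc_int; auto; lra.
Qed.

Lemma circle_mean_minus (f g : C -> C) (s : R) :
  0 <= s -> circle_continuous f s -> circle_continuous g s ->
  circle_mean (fun z => (f z - g z)%C) s = (circle_mean f s - circle_mean g s)%C.
Proof.
  intros Hs Hf Hg. unfold circle_mean, arc_int. assert (P := two_PI_pos).
  rewrite (CInt_minus (fun t => f (RtoC s * cis t)%C) (fun t => g (RtoC s * cis t)%C)).
  - ring.
  - apply ex_arc_int; auto; lra.
  - apply ex_arc_int; auto; lra.
Qed.

Lemma circle_mean_scal (c : C) (f : C -> C) (s : R) :
  0 <= s -> circle_continuous f s ->
  circle_mean (fun z => (c * f z)%C) s = (c * circle_mean f s)%C.
Proof.
  intros Hs Hf. unfold circle_mean, arc_int. assert (P := two_PI_pos).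
  rewrite (CInt_scal c (fun t => f (RtoC s * cis t)%C)).
  - ring.
  - apply ex_arc_int; auto; lra.
Qed.

Lemma circle_mean_bound (f : C -> C) (s M : R) :
  0 <= s -> circle_continuous f s -> (forall z, Cmod z = s -> Cmod (f z) <= M) ->
  Cmod (circle_mean f s) <= M.
Proof.
  intros Hs Hf HM. assert (P := two_PI_pos).
  unfold circle_mean. rewrite Cmod_mult, Cmod_R, Rabs_pos_eq.
  - assert (B : Cmod (arc_int f s 0 (2 * PI)) <= (2 * PI - 0) * M).
    { apply CInt_bound. lra. apply ex_arc_int; auto; lra.
      intros t _. apply HM. now apply Cmod_polar. }
    apply Rmult_le_reg_l with (2 * PI); auto.
    rewrite <- Rmult_assoc, Rinv_r, Rmult_1_l by lra. lra.
  - left. now apply Rinv_0_lt_compat.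
Qed.

Lemma circle_mean_Re (f : C -> C) (s : R) :
  0 <= s -> circle_continuous f s ->
  ex_RInt (fun t => Re (f (RtoC s * cis t)%C)) 0 (2 * PI) /\
  Re (circle_mean f s) = / (2 * PI) * RInt (fun t => Re (f (RtoC s * cis t)%C)) 0 (2 * PI).
Proof.
  intros Hs Hf. assert (P := two_PI_pos).
  assert (E := CInt_correct _ _ _ (ex_arc_int f s 0 (2 * PI) Hs ltac:(lra) Hf)).
  apply is_RInt_Re in E. split.
  - eexists. exact E.
  - unfold circle_mean. rewrite re_scal_l. f_equal. symmetry.
    apply is_RInt_unique. exact E.
Qed.

Lemma circle_mean_Re_le (f g : C -> C) (s : R) :
  0 <= s -> circle_continuous f s -> circle_continuous g s ->
  (forall z, Cmod z = s -> Re (f z) <= Re (g z)) ->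
  Re (circle_mean f s) <= Re (circle_mean g s).
Proof.
  intros Hs Hf Hg H. assert (P := two_PI_pos).
  destruct (circle_mean_Re f s Hs Hf) as [E1 ->].
  destruct (circle_mean_Re g s Hs Hg) as [E2 ->].
  apply Rmult_le_compat_l. left; now apply Rinv_0_lt_compat.
  apply RInt_le; auto; try lra. intros t _. apply H. now apply Cmod_polar.
Qed.

Lemma circle_mean_conj (f : C -> C) (s : R) :
  0 <= s -> circle_continuous f s ->
  circle_mean (fun z => Cconj (f z)) s = Cconj (circle_mean f s).
Proof.
  intros Hs Hf. assert (P := two_PI_pos).
  assert (E := CInt_correct _ _ _ (ex_arc_int f s 0 (2 * PI) Hs ltac:(lra) Hf)).
  unfold circle_mean. rewrite Cmult_conj.
  replace (Cconj (RtoC (/ (2 * PI)))) with (RtoC (/ (2 * PI)))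
    by (apply injective_projections; simpl; ring).
  f_equal. apply CInt_unique.
  apply (@is_RInt_fct_extend_pair R_NormedModule R_NormedModule).
  - exact (is_RInt_Re _ _ _ _ E).
  - exact (is_RInt_opp _ _ _ _ (is_RInt_Im _ _ _ _ E)).
Qed.

Lemma circle_mean_annulus (f : C -> C) (a b : R) :
  0 < a -> a <= b -> (forall z, a <= Cmod z <= b -> holo f z) ->
  circle_mean f a = circle_mean f b.
Proof. intros Ha Hab Hf. unfold circle_mean. now rewrite (arc_int_annulus f a b). Qed.

Lemma circle_mean_0 (f : C -> C) : circle_mean f 0 = f 0%C.
Proof.
  rewrite <- (circle_mean_const (f 0%C) 0).
  apply circle_mean_ext. lra. intros z Hz. now rewrite (Cmod_eq_0 z Hz).
Qed.

Lemma circle_mean_unif (f : C -> C) (r e : R) :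
  (forall z, Cmod z <= r -> continuousC f z) -> 0 < e ->
  exists d, 0 < d /\ forall s s', 0 <= s <= r -> 0 <= s' <= r -> Rabs (s' - s) < d ->
    Cmod (circle_mean f s' - circle_mean f s)%C <= e.
Proof.
  intros Hf He. destruct (closed_disk_unif_continuous f r e Hf He) as [d [Hd H]].
  exists d. split; auto. intros s s' Hs Hs' Hss.
  assert (P := two_PI_pos).
  assert (E : forall s, 0 <= s <= r -> ex_CInt (fun t => f (RtoC s * cis t)%C) 0 (2 * PI)).
  { intros u Hu. apply ex_arc_int; try lra. intros z Hz. apply Hf. lra. }
  unfold circle_mean, arc_int.
  replace (RtoC (/ (2 * PI)) * CInt (fun t => f (RtoC s' * cis t)%C) 0 (2 * PI) -
    RtoC (/ (2 * PI)) * CInt (fun t => f (RtoC s * cis t)%C) 0 (2 * PI))%C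
    with (RtoC (/ (2 * PI)) * CInt (fun t => (f (RtoC s' * cis t) - f (RtoC s * cis t))%C) 0 (2 * PI))%C.
  - rewrite Cmod_mult, Cmod_R, Rabs_pos_eq by (left; now apply Rinv_0_lt_compat).
    apply Rmult_le_reg_l with (2 * PI); auto.
    rewrite <- Rmult_assoc, Rinv_r, Rmult_1_l by lra.
    replace (2 * PI * e) with ((2 * PI - 0) * e) by ring.
    apply CInt_bound. lra.
    + apply (@ex_RInt_minus C_R_NormedModule); apply E; auto.
    + intros t _. left. apply H; try (rewrite Cmod_polar; lra).
      replace (RtoC s' * cis t - RtoC s * cis t)%C with (RtoC (s' - s) * cis t)%C
        by (rewrite RtoC_minus; ring).
      now rewrite Cmod_mult, Cmod_cis, Cmod_R, Rmult_1_r.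
  - rewrite CInt_minus by (apply E; auto). ring.
Qed.

(* A continuous function that is holomorphic off one point still has the mean
   value property: its circle means are constant on both sides of the radius of
   the exceptional point, and they depend continuously on the radius. *)
Lemma circle_mean_removable (q f : C -> C) (w : C) (r : R) :
  Cmod w < r -> (forall z, Cmod z <= r -> continuousC f z) ->
  (forall z, z <> w -> Cmod z <= r -> holo q z) -> (forall z, z <> w -> q z = f z) ->
  circle_mean f r = f 0%C.
Proof.
  intros Hw Hc Hq Hqf. rewrite <- circle_mean_0.
  assert (W := Cmod_ge_0 w).
  assert (Ann : forall a b, 0 < a -> a <= b -> b <= r -> b < Cmod w \/ Cmod w < a ->
      circle_mean f a = circle_mean f b).
  { intros a b H1 H2 H3 H4.
    rewrite <- (circle_mean_ext q f a), <- (circle_mean_ext q f b).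
    - apply circle_mean_annulus; auto. intros z Hz. apply Hq. intros ->. lra. lra.
    - lra.
    - intros z Hz. apply Hqf. intros ->. lra.
    - lra.
    - intros z Hz. apply Hqf. intros ->. lra. }
  apply Ceq_minus. apply Cmod_eq_0, Rle_antisym; [|apply Cmod_ge_0].
  apply le_epsilon. intros e He.
  assert (He2 : 0 < e / 2) by lra.
  destruct (circle_mean_unif f r (e / 2) Hc He2) as [d [Hd H]].
  (* The radii [s2] and [Cmod w - m] lie within [d / 3] of [Cmod w] on its two sides, so crossing
     the exceptional radius costs at most [e / 2]. The passage from radius 0 to [m] costs as much;
     if [w = 0] the two passages are one. *)
  set (s2 := Cmod w + Rmin (d / 3) (r - Cmod w)).
  assert (M1 := Rmin_l (d / 3) (r - Cmod w)). assert (M2 := Rmin_r (d / 3) (r - Cmod w)).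
  assert (M3 : 0 < Rmin (d / 3) (r - Cmod w)) by (apply Rmin_pos; lra).
  rewrite <- (Ann s2 r) by (unfold s2; lra).
  destruct (Req_dec (Cmod w) 0) as [E|E].
  - rewrite Rplus_0_l. left. apply Rle_lt_trans with (e / 2); [|lra].
    apply H; unfold s2; try lra. rewrite Rabs_pos_eq; lra.
  - set (m := Rmin (d / 3) (Cmod w / 2)).
    assert (N1 := Rmin_l (d / 3) (Cmod w / 2)). assert (N2 := Rmin_r (d / 3) (Cmod w / 2)).
    assert (N3 : 0 < m) by (apply Rmin_pos; lra). fold m in N1, N2.
    replace (circle_mean f s2 - circle_mean f 0)%C with
      ((circle_mean f s2 - circle_mean f (Cmod w - m)) + (circle_mean f m - circle_mean f 0))%C.
    + eapply Rle_trans. apply Cmod_triangle.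
      assert (A1 : Cmod (circle_mean f s2 - circle_mean f (Cmod w - m))%C <= e / 2).
      { apply H; unfold s2; try lra. rewrite Rabs_pos_eq; lra. }
      assert (A2 : Cmod (circle_mean f m - circle_mean f 0)%C <= e / 2).
      { apply H; try lra. rewrite Rabs_pos_eq; lra. }
      lra.
    + rewrite (Ann m (Cmod w - m)) by lra. ring.
Qed.

Lemma circle_mean_center (f : C -> C) (r : R) :
  0 < r -> (forall z, Cmod z <= r -> holo f z) -> circle_mean f r = f 0%C.
Proof.
  intros Hr Hf. apply (circle_mean_removable f f 0%C r); auto.
  - now rewrite Cmod_0.
  - intros z Hz. now apply holo_continuous, Hf.
Qed.

Lemma Cmod_minus_neq_0 (z w : C) : Cmod w < Cmod z -> (z - w)%C <> 0%C.
Proof.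
  intros H. apply Cminus_eq_contra. intros ->. lra.
Qed.

Lemma Cmod_pos_neq_0 (z : C) : 0 < Cmod z -> z <> 0%C.
Proof. apply Cmod_gt_0. Qed.

(** The mean does not depend on the radius beyond [Cmod w], and the kernel tends to 1 at
    infinity. *)
Lemma circle_mean_kernel (w : C) (r : R) :
  Cmod w < r -> circle_mean (fun z => (z * / (z - w))%C) r = 1%C.
Proof.
  intros Hw. assert (W := Cmod_ge_0 w).
  set (k := fun z => (z * / (z - w))%C).
  assert (Hk : forall z, Cmod w < Cmod z -> holo k z).
  { intros z Hz. apply holo_mult. apply holo_id. apply holo_inv.
    - now apply Cmod_minus_neq_0.
    - apply holo_minus. apply holo_id. apply holo_const. }
  apply Ceq_minus. apply Cmod_eq_0, Rle_antisym; [|apply Cmod_ge_0].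
  apply le_epsilon. intros e He. rewrite Rplus_0_l.
  (* On this circle [Cmod (z - w)] is at least [Cmod w / e], hence the kernel is within [e] of 1. *)
  set (s := r + Cmod w + Cmod w / e).
  assert (Hs : 0 <= Cmod w / e) by (apply Rdiv_le_0_compat; lra).
  rewrite (circle_mean_annulus k r s).
  - rewrite <- (circle_mean_const 1%C s), <- circle_mean_minus.
    + apply circle_mean_bound.
      * unfold s; lra.
      * intros z Hz. apply Ccontinuous_minus. apply holo_continuous, Hk. unfold s in *; lra.
        apply Ccontinuous_const.
      * intros z Hz. assert (Hz' : Cmod w < Cmod z) by (unfold s in *; lra).
        assert (Hne := Cmod_minus_neq_0 z w Hz').
        replace (k z - 1)%C with (w / (z - w))%C by (unfold k; field; auto).
        rewrite Cmod_div by auto.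
        assert (T := Cmod_triangle_minus z w).
        assert (Hp : 0 < Cmod (z - w)%C) by now apply Cmod_gt_0.
        apply Rmult_le_reg_r with (Cmod (z - w)%C); auto.
        unfold Rdiv at 1. rewrite Rmult_assoc, Rinv_l, Rmult_1_r by lra.
        apply Rle_trans with (e * (Cmod w / e)).
        -- right. field. lra.
        -- apply Rmult_le_compat_l. lra. unfold s in *. lra.
    + unfold s; lra.
    + intros z Hz. apply holo_continuous, Hk. unfold s in *; lra.
    + intros z Hz. apply Ccontinuous_const.
  - lra.
  - unfold s; lra.
  - intros z Hz. apply Hk. lra.
Qed.

(** The slope function [psi] of [g] at [w] extends the difference quotient continuously, so
    [z * psi z] has the mean value property although it is not known to be holomorphic at [w]. Its
    value at 0 is 0, so the mean of [g] against the kernel is [g w] times the mean of the kernel. *)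
Lemma cauchy_formula (g : C -> C) (w : C) (r : R) :
  Cmod w < r -> (forall z, Cmod z <= r -> holo g z) ->
  circle_mean (fun z => (g z * (z * / (z - w)))%C) r = g w.
Proof.
  intros Hw Hg. assert (W := Cmod_ge_0 w).
  destruct (Hg w ltac:(lra)) as [psi [Hpsi Epsi]].
  set (q := fun z => (z * ((g z - g w) * / (z - w)))%C).
  assert (Hq : forall z, z <> w -> Cmod z <= r -> holo q z).
  { intros z Hz Hzr. apply holo_mult. apply holo_id. apply holo_mult.
    - apply holo_minus; auto. apply holo_const.
    - apply holo_inv. now apply Cminus_eq_contra. apply holo_minus.
      apply holo_id. apply holo_const. }
  assert (Hqf : forall z, z <> w -> q z = (z * psi z)%C).
  { intros z Hz. unfold q. rewrite Epsi. field. now apply Cminus_eq_contra. }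
  assert (Cpsi : forall z, Cmod z <= r -> continuousC (fun z => (z * psi z)%C) z).
  { intros z Hz. destruct (Ceq_dec z w) as [->|N].
    - apply Ccontinuous_mult; auto. apply continuous_id.
    - apply continuous_ext_loc with q.
      + assert (Hp : 0 < Cmod (z - w)%C) by (apply Cmod_gt_0; now apply Cminus_eq_contra).
        apply locally_Cmod. exists (Cmod (z - w)%C). split; auto.
        intros y Hy. apply Hqf. intros ->. rewrite Cmod_minus_sym in Hy. lra.
      + now apply holo_continuous, Hq. }
  assert (E := circle_mean_removable q (fun z => (z * psi z)%C) w r Hw Cpsi Hq Hqf).
  simpl in E. rewrite Cmult_0_l in E.
  assert (Ck : forall z, Cmod z = r -> continuousC (fun z => (z * / (z - w))%C) z).
  { intros z Hz. apply Ccontinuous_mult. apply continuous_id. apply Ccontinuous_inv.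
    apply Cmod_minus_neq_0. lra. apply Ccontinuous_minus. apply continuous_id. apply Ccontinuous_const. }
  rewrite (circle_mean_ext _ (fun z => (g z * (z * / (z - w)) - g w * (z * / (z - w)))%C)) in E.
  - rewrite circle_mean_minus, circle_mean_scal, circle_mean_kernel in E; auto; try lra.
    + rewrite Cmult_1_r in E. now apply Ceq_minus.
    + intros z Hz. apply Ccontinuous_mult; auto. apply holo_continuous, Hg. lra.
    + intros z Hz. apply Ccontinuous_mult; auto. apply Ccontinuous_const.
  - lra.
  - intros z Hz. assert (N : z <> w) by (intros ->; lra).
    rewrite <- Hqf by auto. unfold q. ring.
Qed.

Fixpoint csum (f : nat -> C) (n : nat) : C :=
  match n with
  | O => 0%C
  | S k => (csum f k + f k)%C
  end.

(** Cauchy's coefficient integral: dz / (2 pi i z^(m+1)) is z^(-m) dt / (2 pi) on the circle. *)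
Definition taylor_coef (g : C -> C) (r : R) (m : nat) : C :=
  circle_mean (fun z => (g z * (/ z) ^ m)%C) r.

Lemma Cmod_inv_pow (z : C) (m : nat) :
  0 < Cmod z -> Cmod ((/ z) ^ m)%C = (/ Cmod z) ^ m.
Proof. intros H. rewrite Cmod_pow, Cmod_inv; auto. now apply Cmod_gt_0. Qed.

Lemma circle_continuous_inv_pow (r : R) (m : nat) :
  0 < r -> circle_continuous (fun z => ((/ z) ^ m)%C) r.
Proof.
  intros Hr z Hz. apply Ccontinuous_pow, Ccontinuous_inv.
  apply Cmod_pos_neq_0; lra. apply continuous_id.
Qed.

Lemma taylor_coef_bound (g : C -> C) (r K : R) (m : nat) :
  0 < r -> circle_continuous g r -> (forall z, Cmod z = r -> Cmod (g z) <= K) ->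
  Cmod (taylor_coef g r m) <= K * (/ r) ^ m.
Proof.
  intros Hr Hg HK. apply circle_mean_bound. lra.
  - intros z Hz. apply Ccontinuous_mult; auto. now apply (circle_continuous_inv_pow r).
  - intros z Hz. rewrite Cmod_mult, Cmod_inv_pow, Hz by lra.
    apply Rmult_le_compat_r; auto. apply pow_le. left. now apply Rinv_0_lt_compat.
Qed.

(** This lets one coefficient be estimated on whichever circle gives the better bound. *)
Lemma taylor_coef_radius (g : C -> C) (r r' : R) (m : nat) :
  0 < r -> r <= r' -> (forall z, Cmod z <= r' -> holo g z) ->
  taylor_coef g r m = taylor_coef g r' m.
Proof.
  intros Hr Hr' Hg. apply circle_mean_annulus; auto. intros z Hz.
  apply holo_mult. apply Hg; lra. apply holo_pow, holo_inv.
  apply Cmod_pos_neq_0; lra. apply holo_id.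
Qed.

(** Iterating z/(z-w) = 1 + (w/z) z/(z-w) in Cauchy's formula produces the Taylor sum and an exact
    remainder. The bound depends on [g] only through [K], so it can later be applied to all powers
    of [phi] at once. *)
Lemma taylor_remainder (g : C -> C) (w : C) (r K : R) (k : nat) :
  Cmod w < r -> (forall z, Cmod z <= r -> holo g z) ->
  (forall z, Cmod z = r -> Cmod (g z) <= K) ->
  Cmod (g w - csum (fun m => taylor_coef g r m * w ^ m)%C k)%C
    <= K * (Cmod w / r) ^ k * (r / (r - Cmod w)).
Proof.
  intros Hw Hg HK. assert (W := Cmod_ge_0 w).
  set (ker := fun z => (z * / (z - w))%C).
  set (rem := fun k => circle_mean (fun z => (g z * (/ z) ^ k * ker z)%C) r).
  assert (Ck : circle_continuous ker r).
  { intros z Hz. apply Ccontinuous_mult. apply continuous_id. apply Ccontinuous_inv.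
    apply Cmod_minus_neq_0. lra. apply Ccontinuous_minus. apply continuous_id. apply Ccontinuous_const. }
  assert (Cg : circle_continuous g r) by (intros z Hz; apply holo_continuous, Hg; lra).
  assert (Cp : forall m, circle_continuous (fun z => (g z * (/ z) ^ m)%C) r).
  { intros m z Hz. apply Ccontinuous_mult; auto. apply (circle_continuous_inv_pow r); auto. lra. }
  assert (Crem : forall m, circle_continuous (fun z => (g z * (/ z) ^ m * ker z)%C) r).
  { intros m z Hz. apply Ccontinuous_mult; auto. apply (Cp m z Hz). }
  assert (Hrec : forall m, rem m = (taylor_coef g r m + w * rem (S m))%C).
  { intros m. unfold rem, taylor_coef.
    rewrite <- circle_mean_scal, <- circle_mean_plus; auto; try lra.
    - apply circle_mean_ext. lra. intros z Hz. unfold ker; simpl. field. split.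
      + apply Cmod_minus_neq_0; lra.
      + apply Cmod_pos_neq_0; lra.
    - intros z Hz. apply Ccontinuous_mult. apply Ccontinuous_const. now apply (Crem (S m)). }
  assert (H0 : rem 0%nat = g w).
  { rewrite <- (cauchy_formula g w r Hw Hg). unfold rem.
    apply (circle_mean_ext (fun z => (g z * (/ z) ^ 0 * ker z)%C)
      (fun z => (g z * ker z)%C)). lra.
    intros z Hz. change ((/ z) ^ 0)%C with (RtoC 1). now rewrite Cmult_1_r. }
  assert (Hexp : forall k, (g w - csum (fun m => taylor_coef g r m * w ^ m)%C k = w ^ k * rem k)%C).
  { induction k0 as [|j IH]; simpl.
    - rewrite H0. ring.
    - replace (g w - (csum (fun m => taylor_coef g r m * w ^ m) j + taylor_coef g r j * w ^ j))%C
        with ((g w - csum (fun m => taylor_coef g r m * w ^ m) j) - taylor_coef g r j * w ^ j)%C by ring.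
      rewrite IH, (Hrec j). ring. }
  rewrite Hexp, Cmod_mult, Cmod_pow.
  assert (B : Cmod (rem k) <= K * (/ r) ^ k * (r / (r - Cmod w))).
  { unfold rem. apply circle_mean_bound; [lra|apply (Crem k)|]. intros z Hz. unfold ker.
    rewrite !Cmod_mult, Cmod_inv_pow, Hz by lra.
    assert (Hne := Cmod_minus_neq_0 z w ltac:(lra)).
    rewrite Cmod_inv by auto.
    assert (Pi : 0 <= (/ r) ^ k) by (apply pow_le; left; apply Rinv_0_lt_compat; lra).
    assert (T := Cmod_triangle_minus z w).
    apply Rmult_le_compat.
    - apply Rmult_le_pos; auto. apply Cmod_ge_0.
    - apply Rmult_le_pos. lra. left. apply Rinv_0_lt_compat. lra.
    - apply Rmult_le_compat_r; auto.
    - apply Rmult_le_compat_l. lra. apply Rinv_le_contravar; lra. }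
  apply Rle_trans with (Cmod w ^ k * (K * (/ r) ^ k * (r / (r - Cmod w)))).
  - apply Rmult_le_compat_l; auto. now apply pow_le.
  - right. unfold Rdiv. rewrite Rpow_mult_distr. ring.
Qed.

(** * Subordination on the Hardy space *)

Fixpoint rsum (f : nat -> R) (n : nat) : R :=
  match n with
  | O => 0
  | S k => rsum f k + f k
  end.

Lemma csum_ext (f g : nat -> C) (n : nat) :
  (forall k, (k < n)%nat -> f k = g k) -> csum f n = csum g n.
Proof.
  induction n as [|n IH]; intros H; simpl; auto.
  rewrite IH, H; auto.
Qed.

Lemma rsum_ext (f g : nat -> R) (n : nat) :
  (forall k, (k < n)%nat -> f k = g k) -> rsum f n = rsum g n.
Proof.
  induction n as [|n IH]; intros H; simpl; auto.
  rewrite IH, H; auto.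
Qed.

Lemma csum_shift (f : nat -> C) (n : nat) :
  csum f (S n) = (f 0%nat + csum (fun k => f (S k)) n)%C.
Proof. induction n as [|n IH]; simpl in *. ring. rewrite IH. ring. Qed.

Lemma csum_scal (c : C) (f : nat -> C) (n : nat) :
  csum (fun k => (c * f k)%C) n = (c * csum f n)%C.
Proof. induction n as [|n IH]; simpl. ring. rewrite IH. ring. Qed.

Lemma rsum_shift (f : nat -> R) (n : nat) :
  rsum f (S n) = f 0%nat + rsum (fun k => f (S k)) n.
Proof. induction n as [|n IH]; simpl in *. ring. rewrite IH. ring. Qed.

(** * Mean squares on the unit circle and Bessel's inequality *)

Definition L2sq (f : C -> C) : R := Re (circle_mean (fun z => (f z * Cconj (f z))%C) 1).

Lemma Re_mult_conj (z : C) : Re (z * Cconj z)%C = Cmod z ^ 2.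
Proof. now rewrite <- Cmod2_conj, re_RtoC. Qed.

Lemma circle_continuous_mult_conj (f g : C -> C) (s : R) :
  circle_continuous f s -> circle_continuous g s ->
  circle_continuous (fun z => (f z * Cconj (g z))%C) s.
Proof. intros Hf Hg z Hz. apply Ccontinuous_mult; auto. apply Ccontinuous_conj; auto. Qed.

Lemma L2sq_le (f g : C -> C) :
  circle_continuous f 1 -> circle_continuous g 1 ->
  (forall z, Cmod z = 1 -> Cmod (f z) <= Cmod (g z)) -> L2sq f <= L2sq g.
Proof.
  intros Hf Hg H. apply circle_mean_Re_le.
  - lra.
  - now apply circle_continuous_mult_conj.
  - now apply circle_continuous_mult_conj.
  - intros z Hz. rewrite !Re_mult_conj. apply pow_incr. split; auto. apply Cmod_ge_0.
Qed.

Lemma L2sq_ge_0 (f : C -> C) : circle_continuous f 1 -> 0 <= L2sq f.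
Proof.
  intros Hf. replace 0 with (L2sq (fun _ => 0%C)).
  - apply L2sq_le; auto.
    + intros z _. apply Ccontinuous_const.
    + intros z _. rewrite Cmod_0. apply Cmod_ge_0.
  - unfold L2sq. rewrite circle_mean_const. simpl. ring.
Qed.

Lemma L2sq_const_plus (c : C) (f : C -> C) :
  circle_continuous f 1 ->
  L2sq (fun z => (c + f z)%C) =
    Cmod c ^ 2 + 2 * Re (Cconj c * circle_mean f 1)%C + L2sq f.
Proof.
  intros Hf. unfold L2sq.
  assert (C1 : circle_continuous (fun z => (Cconj c * f z)%C) 1).
  { intros z Hz. apply Ccontinuous_mult; auto. apply Ccontinuous_const. }
  assert (C2 : circle_continuous (fun z => Cconj (Cconj c * f z)%C) 1).
  { intros z Hz. apply Ccontinuous_conj; auto. }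
  rewrite (circle_mean_ext _
     (fun z => ((c * Cconj c + (Cconj c * f z + Cconj (Cconj c * f z))) + f z * Cconj (f z))%C)).
  - rewrite circle_mean_plus, circle_mean_plus, circle_mean_plus, circle_mean_const,
      circle_mean_conj, circle_mean_scal; auto; try lra.
    + rewrite !re_plus, re_conj, Re_mult_conj. ring.
    + intros z Hz. apply Ccontinuous_const.
    + intros z Hz. apply Ccontinuous_plus; auto.
    + intros z Hz. apply Ccontinuous_plus. apply Ccontinuous_const. apply Ccontinuous_plus; auto.
    + now apply circle_continuous_mult_conj.
  - lra.
  - intros z Hz. rewrite Cplus_conj, Cmult_conj, Cconj_conj. ring.
Qed.

Lemma Cinv_unit (z : C) : Cmod z = 1 -> (/ z)%C = Cconj z.
Proof.
  intros Hz. assert (N : z <> 0%C) by (apply Cmod_pos_neq_0; lra).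
  assert (E := Cmod2_conj z). rewrite Hz, pow1 in E.
  replace (Cconj z) with ((z * Cconj z) * / z)%C by (field; auto).
  rewrite <- E. ring.
Qed.

(** Orthogonality of the monomials. Positive powers have mean 0 by the mean value property; negative
    powers are their conjugates on the unit circle. *)
Lemma taylor_coef_pow (j k : nat) :
  taylor_coef (fun z => (z ^ j)%C) 1 k = if Nat.eq_dec j k then 1%C else 0%C.
Proof.
  assert (Hm : forall n, circle_mean (fun z => (z ^ S n)%C) 1 = 0%C).
  { intros n. rewrite circle_mean_center; [simpl; ring|lra|].
    intros z _. apply holo_pow, holo_id. }
  unfold taylor_coef. destruct (Nat.eq_dec j k) as [->|N].
  - rewrite <- (circle_mean_const 1%C 1). apply circle_mean_ext. lra.
    intros z Hz. rewrite <- Cpow_mult_l, Cinv_r, Cpow_1_l; auto. apply Cmod_pos_neq_0; lra.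
  - destruct (Nat.lt_ge_cases k j) as [L|L].
    + rewrite <- (Hm (j - k - 1)%nat). apply circle_mean_ext. lra.
      intros z Hz. replace j with (S (j - k - 1) + k)%nat at 1 by lia.
      rewrite Cpow_add_r, <- Cmult_assoc, <- Cpow_mult_l, Cinv_r, Cpow_1_l. ring.
      apply Cmod_pos_neq_0; lra.
    + replace (RtoC 0) with (Cconj (circle_mean (fun z => (z ^ S (k - j - 1))%C) 1))
        by (rewrite Hm; apply injective_projections; simpl; ring).
      rewrite <- circle_mean_conj.
      * apply circle_mean_ext. lra. intros z Hz.
        rewrite Cpow_conj, <- Cinv_unit by auto.
        replace k with (j + S (k - j - 1))%nat at 1 by lia.
        rewrite Cpow_add_r, Cmult_assoc, <- Cpow_mult_l, Cinv_r, Cpow_1_l. ring.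
        apply Cmod_pos_neq_0; lra.
      * lra.
      * intros z Hz. apply Ccontinuous_pow, continuous_id.
Qed.

Lemma taylor_coef_minus (f g : C -> C) (r : R) (m : nat) :
  0 < r -> circle_continuous f r -> circle_continuous g r ->
  taylor_coef (fun z => (f z - g z)%C) r m = (taylor_coef f r m - taylor_coef g r m)%C.
Proof.
  intros Hr Hf Hg. unfold taylor_coef. rewrite <- circle_mean_minus.
  - apply circle_mean_ext. lra. intros; ring.
  - lra.
  - intros z Hz. apply Ccontinuous_mult; auto. now apply (circle_continuous_inv_pow r).
  - intros z Hz. apply Ccontinuous_mult; auto. now apply (circle_continuous_inv_pow r).
Qed.

Lemma taylor_coef_plus (f g : C -> C) (r : R) (m : nat) :
  0 < r -> circle_continuous f r -> circle_continuous g r ->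
  taylor_coef (fun z => (f z + g z)%C) r m = (taylor_coef f r m + taylor_coef g r m)%C.
Proof.
  intros Hr Hf Hg. unfold taylor_coef. rewrite <- circle_mean_plus.
  - apply circle_mean_ext. lra. intros; ring.
  - lra.
  - intros z Hz. apply Ccontinuous_mult; auto. now apply (circle_continuous_inv_pow r).
  - intros z Hz. apply Ccontinuous_mult; auto. now apply (circle_continuous_inv_pow r).
Qed.

Lemma taylor_coef_scal (c : C) (f : C -> C) (r : R) (m : nat) :
  0 < r -> circle_continuous f r ->
  taylor_coef (fun z => (c * f z)%C) r m = (c * taylor_coef f r m)%C.
Proof.
  intros Hr Hf. unfold taylor_coef. rewrite <- circle_mean_scal.
  - apply circle_mean_ext. lra. intros; ring.
  - lra.
  - intros z Hz. apply Ccontinuous_mult; auto. now apply (circle_continuous_inv_pow r).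
Qed.

(** Pythagoras for one monomial: the cross terms equal twice the square of the coefficient, and the
    monomial has modulus 1 on the circle. *)
Lemma L2sq_minus_monomial (f : C -> C) (k : nat) :
  circle_continuous f 1 ->
  L2sq (fun z => (f z - taylor_coef f 1 k * z ^ k)%C) =
    L2sq f - Cmod (taylor_coef f 1 k) ^ 2.
Proof.
  intros Hf. set (c := taylor_coef f 1 k).
  set (h := fun z => (Cconj c * (f z * (/ z) ^ k))%C).
  assert (Ch0 : circle_continuous (fun z => (f z * (/ z) ^ k)%C) 1).
  { intros z Hz. apply Ccontinuous_mult; auto. apply (circle_continuous_inv_pow 1); auto. lra. }
  assert (Ch : circle_continuous h 1).
  { intros z Hz. apply Ccontinuous_mult. apply Ccontinuous_const. auto. }
  assert (Chc : circle_continuous (fun z => Cconj (h z)) 1).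
  { intros z Hz. apply Ccontinuous_conj; auto. }
  assert (Eh : circle_mean h 1 = (Cconj c * c)%C).
  { unfold h. rewrite circle_mean_scal; auto. lra. }
  unfold L2sq. rewrite (circle_mean_ext _
     (fun z => ((f z * Cconj (f z) - (h z + Cconj (h z))) + c * Cconj c)%C)).
  - rewrite circle_mean_plus, circle_mean_minus, circle_mean_plus, circle_mean_conj,
      circle_mean_const, Eh; auto; try lra.
    + unfold Cminus. rewrite !re_plus, re_opp, re_plus, re_conj, (Cmult_comm (Cconj c)), !Re_mult_conj. ring.
    + now apply circle_continuous_mult_conj.
    + intros z Hz. apply Ccontinuous_plus; auto.
    + intros z Hz. apply Ccontinuous_minus. now apply (circle_continuous_mult_conj f f 1).
      apply Ccontinuous_plus; auto.
    + intros z Hz. apply Ccontinuous_const.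
  - lra.
  - intros z Hz. unfold h.
    assert (E : ((/ z) ^ k)%C = Cconj (z ^ k)%C) by now rewrite Cpow_conj, Cinv_unit.
    assert (E2 : (z ^ k * Cconj (z ^ k))%C = 1%C).
    { rewrite <- Cmod2_conj, Cmod_pow, Hz, !pow1. reflexivity. }
    rewrite E, Cminus_conj, !Cmult_conj, !Cconj_conj.
    replace (c * Cconj c)%C with (c * Cconj c * (z ^ k * Cconj (z ^ k)))%C by (rewrite E2; ring).
    ring.
Qed.

(** Coefficients are removed one at a time. By orthogonality the later ones do not change, each
    removal lowers the mean square by the square of the coefficient, and what remains is
    nonnegative. *)
Lemma bessel (g : C -> C) (n : nat) :
  circle_continuous g 1 ->
  rsum (fun m => Cmod (taylor_coef g 1 m) ^ 2) n <= L2sq g.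
Proof.
  intros Hg. set (c := taylor_coef g 1).
  set (G := fun j z => (g z - csum (fun m => c m * z ^ m) j)%C).
  assert (Cs : forall j, circle_continuous (fun z => csum (fun m => (c m * z ^ m)%C) j) 1).
  { induction j as [|j IH]; intros z Hz; simpl. apply Ccontinuous_const.
    apply Ccontinuous_plus. auto. apply Ccontinuous_mult. apply Ccontinuous_const.
    apply Ccontinuous_pow, continuous_id. }
  assert (CG : forall j, circle_continuous (G j) 1).
  { intros j z Hz. apply Ccontinuous_minus; auto. now apply Cs. }
  assert (EG : forall j z, G (S j) z = (G j z - c j * z ^ j)%C) by (intros; unfold G; simpl; ring).
  assert (Cm : forall j, circle_continuous (fun z => (c j * z ^ j)%C) 1).
  { intros j z Hz. apply Ccontinuous_mult. apply Ccontinuous_const.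
    apply Ccontinuous_pow, continuous_id. }
  assert (Ecoef : forall j k, (j <= k)%nat -> taylor_coef (G j) 1 k = c k).
  { induction j as [|j IH]; intros k Hk.
    - unfold c, taylor_coef. apply circle_mean_ext. lra. intros z _. unfold G; simpl. ring.
    - unfold taylor_coef at 1. rewrite (circle_mean_ext _ (fun z => ((G j z - c j * z ^ j) * (/ z) ^ k)%C)).
      + change (taylor_coef (fun z => (G j z - c j * z ^ j)%C) 1 k = c k).
        rewrite taylor_coef_minus, taylor_coef_scal, taylor_coef_pow, IH; auto; try lra; try lia.
        * destruct (Nat.eq_dec j k); [lia|]. ring.
        * intros z _. apply Ccontinuous_pow, continuous_id.
      + lra.
      + intros z _. now rewrite EG. }
  assert (E : forall j, L2sq (G j) = L2sq g - rsum (fun m => Cmod (c m) ^ 2) j).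
  { induction j as [|j IH]; simpl rsum.
    - rewrite Rminus_0_r. unfold L2sq. f_equal. apply circle_mean_ext. lra.
      intros z _. replace (G 0%nat z) with (g z) by (unfold G; simpl; ring). reflexivity.
    - assert (M := L2sq_minus_monomial (G j) j (CG j)). rewrite Ecoef in M by lia.
      replace (L2sq (G (S j))) with (L2sq (fun z => (G j z - c j * z ^ j)%C)).
      + rewrite M, IH. simpl. ring.
      + unfold L2sq. f_equal. apply circle_mean_ext. lra. intros z _. now rewrite EG. }
  specialize (E n). assert (P := L2sq_ge_0 _ (CG n)). lra.
Qed.

Lemma holo_csum_pow (y : nat -> C) (phi : C -> C) (n : nat) (z : C) :
  holo phi z -> holo (fun z => csum (fun k => (y k * phi z ^ k)%C) n) z.
Proof.
  intros H. induction n as [|n IH]; simpl. apply holo_const.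
  apply holo_plus; auto. apply holo_mult. apply holo_const. now apply holo_pow.
Qed.

(* Littlewood subordination for polynomials. Writing p = y_0 + z q, the mean
   value property computes the cross term of |y_0 + phi q(phi)|^2, and
   |p(phi(0))|^2 is the extra quantity that makes the induction close. *)
Lemma subordination (phi : C -> C) :
  (forall z, Cmod z <= 1 -> holo phi z) ->
  (forall z, Cmod z = 1 -> Cmod (phi z) <= 1) -> Cmod (phi 0%C) < 1 ->
  forall (n : nat) (y : nat -> C),
  L2sq (fun z => csum (fun k => (y k * phi z ^ k)%C) n) +
    Cmod (csum (fun k => (y k * phi 0%C ^ k)%C) n) ^ 2 <=
  (2 + 4 / (1 - Cmod (phi 0%C) ^ 2)) * rsum (fun k => Cmod (y k) ^ 2) n.
Proof.
  intros Hh Hle H0.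
  set (a := phi 0%C) in *. set (al := Cmod a) in *.
  assert (Hal : 0 <= al) by apply Cmod_ge_0.
  assert (Hd : 0 < 1 - al ^ 2) by nra.
  set (H := 2 + 4 / (1 - al ^ 2)).
  induction n as [|n IH]; intros y.
  - change (Re (circle_mean (fun _ => (RtoC 0 * Cconj (RtoC 0))%C) 1) + Cmod (RtoC 0) ^ 2 <= H * 0).
    rewrite circle_mean_const, Cmod_0. simpl. lra.
  - set (q := fun x => csum (fun k => (y (S k) * x ^ k)%C) n).
    assert (Hq : forall x, csum (fun k => (y k * x ^ k)%C) (S n) = (y 0%nat + x * q x)%C).
    { intros x. rewrite csum_shift. simpl (x ^ 0)%C. unfold q. rewrite <- csum_scal.
      rewrite Cmult_1_r. f_equal. apply csum_ext. intros k _. simpl. ring. }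
    assert (Hhq : forall z, Cmod z <= 1 -> holo (fun z => q (phi z)) z).
    { intros z Hz. apply (holo_csum_pow (fun k => y (S k)) phi n z). auto. }
    assert (Hhpq : forall z, Cmod z <= 1 -> holo (fun z => (phi z * q (phi z))%C) z).
    { intros z Hz. apply holo_mult; auto. }
    rewrite Hq. rewrite rsum_shift.
    replace (L2sq (fun z => csum (fun k => (y k * phi z ^ k)%C) (S n)))
      with (L2sq (fun z => (y 0%nat + phi z * q (phi z))%C)).
    2:{ unfold L2sq. f_equal. apply circle_mean_ext. lra. intros z _. now rewrite Hq. }
    rewrite (L2sq_const_plus (y 0%nat) (fun z => (phi z * q (phi z))%C)).
    2:{ intros z Hz. apply holo_continuous, Hhpq. lra. }
    (* The cross term becomes a value at 0, controlled by [Cmod (q a)], which is why that quantity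
       is carried in the induction. *)
    rewrite circle_mean_center; auto; try lra. fold a.
    assert (L : L2sq (fun z => (phi z * q (phi z))%C) <= L2sq (fun z => q (phi z))).
    { apply L2sq_le.
      - intros z Hz. apply holo_continuous, Hhpq. lra.
      - intros z Hz. apply holo_continuous, Hhq. lra.
      - intros z Hz. rewrite Cmod_mult. assert (X := Hle z Hz). assert (Y := Cmod_ge_0 (q (phi z))). nra. }
    assert (IH' : L2sq (fun z => q (phi z)) + Cmod (q a) ^ 2 <=
      H * rsum (fun k => Cmod (y (S k)) ^ 2) n) by exact (IH (fun k => y (S k))).
    clear IH. rename IH' into IH.
    set (A := Cmod (y 0%nat)). set (B := Cmod (q a)) in *.
    assert (HA : 0 <= A) by apply Cmod_ge_0. assert (HB : 0 <= B) by apply Cmod_ge_0.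
    assert (R1 : Re (Cconj (y 0%nat) * (a * q a))%C <= A * (al * B)).
    { eapply Rle_trans. apply Rle_abs. eapply Rle_trans. apply re_le_Cmod.
      rewrite !Cmod_mult, Cmod_conj. unfold A, B, al. lra. }
    assert (R2 : Cmod (y 0%nat + a * q a)%C ^ 2 <= (A + al * B) ^ 2).
    { apply pow_incr. split. apply Cmod_ge_0. eapply Rle_trans. apply Cmod_triangle.
      rewrite Cmod_mult. unfold A, B, al. lra. }
    (* With [c = 1 - al ^ 2], completing the square in [B] bounds the left side by
       [2 * A ^ 2 + 4 * al ^ 2 * A ^ 2 / c]. As [al <= 1], this is where the constant [2 + 4 / c]
       comes from. *)
    assert (K : 2 * A ^ 2 + 4 * (al * (A * B)) - (1 - al ^ 2) * B ^ 2 <= H * A ^ 2).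
    { set (c := 1 - al ^ 2) in *. unfold H.
      apply Rmult_le_reg_l with c; auto.
      replace (c * ((2 + 4 / c) * A ^ 2)) with (2 * c * A ^ 2 + 4 * A ^ 2) by (field; lra).
      assert (S1 : 0 <= (c * B - 2 * (al * A)) ^ 2) by apply pow2_ge_0.
      assert (S2 : al ^ 2 * A ^ 2 <= 1 * A ^ 2) by (apply Rmult_le_compat_r; [apply pow2_ge_0|unfold c in Hd; lra]).
      nra. }
    clear - R1 R2 K IH L. lra.
Qed.

Lemma taylor_coef_csum (y : nat -> C) (phi : C -> C) (n m : nat) :
  circle_continuous phi 1 ->
  taylor_coef (fun z => csum (fun k => (y k * phi z ^ k)%C) n) 1 m =
  csum (fun k => (y k * taylor_coef (fun z => (phi z ^ k)%C) 1 m)%C) n.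
Proof.
  intros Hc.
  assert (Cp : forall k, circle_continuous (fun z => (phi z ^ k)%C) 1).
  { intros k z Hz. apply Ccontinuous_pow; auto. }
  assert (Cs : forall j, circle_continuous (fun z => csum (fun k => (y k * phi z ^ k)%C) j) 1).
  { induction j as [|j IH]; intros z Hz; simpl. apply Ccontinuous_const.
    apply Ccontinuous_plus. auto. apply Ccontinuous_mult. apply Ccontinuous_const. now apply Cp. }
  induction n as [|n IH]; simpl.
  - transitivity (circle_mean (fun _ => RtoC 0) 1); [|apply circle_mean_const].
    unfold taylor_coef. apply circle_mean_ext. lra. intros z _. apply Cmult_0_l.
  - rewrite taylor_coef_plus, IH, taylor_coef_scal; auto; try lra.
    intros z Hz. apply Ccontinuous_mult. apply Ccontinuous_const. now apply Cp.
Qed.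

(** Bessel's inequality for the polynomial in [phi], followed by subordination, turns the function
    estimate into a bound on finite sections of the matrix. *)
Lemma composition_H2_bound (phi : C -> C) :
  (forall z, Cmod z <= 1 -> holo phi z) ->
  (forall z, Cmod z = 1 -> Cmod (phi z) <= 1) -> Cmod (phi 0%C) < 1 ->
  exists H, 0 <= H /\ forall (n k : nat) (y : nat -> C),
  rsum (fun m => Cmod (csum (fun j => (y j * taylor_coef (fun z => (phi z ^ j)%C) 1 m)%C) n) ^ 2) k
    <= H * rsum (fun j => Cmod (y j) ^ 2) n.
Proof.
  intros Hh Hle H0. exists (2 + 4 / (1 - Cmod (phi 0%C) ^ 2)). split.
  - assert (0 <= Cmod (phi 0%C)) by apply Cmod_ge_0.
    assert (0 < 4 / (1 - Cmod (phi 0%C) ^ 2)) by (apply Rdiv_lt_0_compat; nra). lra.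
  - intros n k y. set (p := fun z => csum (fun j => (y j * phi z ^ j)%C) n).
    assert (Cphi : circle_continuous phi 1) by (intros z Hz; apply holo_continuous, Hh; lra).
    assert (Bs : rsum (fun m => Cmod (taylor_coef p 1 m) ^ 2) k <= L2sq p).
    { apply bessel. intros z Hz. apply holo_continuous, holo_csum_pow, Hh. lra. }
    assert (S := subordination phi Hh Hle H0 n y). fold (p 0%C) in S.
    change (fun z => csum (fun k => (y k * phi z ^ k)%C) n) with p in S.
    assert (P := pow2_ge_0 (Cmod (p 0%C))).
    rewrite (rsum_ext _ (fun m => Cmod (taylor_coef p 1 m) ^ 2)).
    + unfold p in *. lra.
    + intros m _. unfold p. now rewrite taylor_coef_csum.
Qed.

(** * Slowly oscillating weights *)

Lemma rsum_le (f g : nat -> R) (n : nat) :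
  (forall k, (k < n)%nat -> f k <= g k) -> rsum f n <= rsum g n.
Proof.
  induction n as [|n IH]; intros H; simpl. lra.
  apply Rplus_le_compat; auto.
Qed.

Lemma rsum_nonneg (f : nat -> R) (n : nat) :
  (forall k, 0 <= f k) -> 0 <= rsum f n.
Proof. intros H. induction n as [|n IH]; simpl. lra. specialize (H n). lra. Qed.

Lemma rsum_plus (f g : nat -> R) (n : nat) :
  rsum (fun k => f k + g k) n = rsum f n + rsum g n.
Proof. induction n as [|n IH]; simpl. ring. rewrite IH. ring. Qed.

Lemma rsum_scal (c : R) (f : nat -> R) (n : nat) :
  rsum (fun k => c * f k) n = c * rsum f n.
Proof. induction n as [|n IH]; simpl. ring. rewrite IH. ring. Qed.

Lemma rsum_swap (f : nat -> nat -> R) (n k : nat) :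
  rsum (fun i => rsum (fun j => f i j) k) n = rsum (fun j => rsum (fun i => f i j) n) k.
Proof.
  induction n as [|n IH]; simpl.
  - induction k as [|k IH]; simpl; lra.
  - rewrite IH, <- rsum_plus. reflexivity.
Qed.

Lemma rsum_single (f : nat -> R) (j n : nat) :
  (j < n)%nat -> rsum (fun i => if Nat.eqb i j then f i else 0) n = f j.
Proof.
  assert (Z : forall n, (n <= j)%nat -> rsum (fun i => if Nat.eqb i j then f i else 0) n = 0).
  { induction n0 as [|n0 IH]; intros H; simpl; auto.
    rewrite IH by lia. destruct (Nat.eqb_spec n0 j); [lia|lra]. }
  induction n as [|n IH]; intros H; simpl. lia.
  destruct (Nat.eqb_spec n j) as [->|N].
  - rewrite Z by lia. lra.
  - rewrite IH by lia. lra.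
Qed.

Lemma rsum_geom (q : R) (n : nat) : 0 <= q < 1 -> rsum (fun k => q ^ k) n <= / (1 - q).
Proof.
  intros Hq. assert (E : (1 - q) * rsum (fun k => q ^ k) n = 1 - q ^ n).
  { induction n as [|n IH]; simpl. ring. rewrite Rmult_plus_distr_l, IH. ring. }
  assert (P : 0 <= q ^ n) by (apply pow_le; lra).
  apply Rmult_le_reg_l with (1 - q). lra. rewrite E, Rinv_r by lra. lra.
Qed.

Lemma Cmod_csum_le (f : nat -> C) (n : nat) :
  Cmod (csum f n) <= rsum (fun k => Cmod (f k)) n.
Proof.
  induction n as [|n IH]; simpl. rewrite Cmod_0; lra.
  eapply Rle_trans. apply Cmod_triangle. lra.
Qed.

Lemma csum_plus (f g : nat -> C) (n : nat) :
  csum (fun k => (f k + g k)%C) n = (csum f n + csum g n)%C.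
Proof. induction n as [|n IH]; simpl. ring. rewrite IH. ring. Qed.

Lemma weighted_cauchy_schwarz (w t : nat -> R) (n : nat) :
  (forall k, 0 <= w k) ->
  rsum (fun k => w k * t k) n ^ 2 <= rsum w n * rsum (fun k => w k * t k ^ 2) n.
Proof.
  intros Hw. induction n as [|n IH]; [simpl; lra|].
  cbn [rsum]. set (S := rsum (fun k => w k * t k) n) in *. set (W := rsum w n) in *.
  set (Q := rsum (fun k => w k * t k ^ 2) n) in *.
  assert (HW : 0 <= W) by now apply rsum_nonneg.
  assert (HQ : 0 <= Q).
  { apply rsum_nonneg. intros k. apply Rmult_le_pos; auto. apply pow2_ge_0. }
  specialize (Hw n). set (v := w n) in *. set (u := t n).
  (* The induction hypothesis [S ^ 2 <= W * Q] and the arithmetic-geometric mean inequality control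
     the cross term of the new square. *)
  assert (E : 2 * S * u <= W * u ^ 2 + Q).
  { assert (P : 0 <= W * u ^ 2 + Q).
    { apply Rplus_le_le_0_compat; auto. apply Rmult_le_pos; auto. apply pow2_ge_0. }
    apply Rle_trans with (1 := Rle_abs _).
    rewrite <- (Rabs_pos_eq _ P). apply Rsqr_le_abs_0. unfold Rsqr.
    assert (P1 := pow2_ge_0 (W * u ^ 2 - Q)).
    assert (P2 : S ^ 2 * u ^ 2 <= W * Q * u ^ 2).
    { apply Rmult_le_compat_r; auto. apply pow2_ge_0. }
    nra. }
  assert (E2 : v * (2 * S * u) <= v * (W * u ^ 2 + Q)) by now apply Rmult_le_compat_l.
  nra.
Qed.

Lemma pow_le_pow_le1 (q : R) (n m : nat) : 0 <= q <= 1 -> (n <= m)%nat -> q ^ m <= q ^ n.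
Proof.
  intros Hq H. replace m with (n + (m - n))%nat by lia. rewrite pow_add.
  rewrite <- (Rmult_1_r (q ^ n)) at 2. apply Rmult_le_compat_l. apply pow_le; lra.
  rewrite <- (pow1 (m - n)). apply pow_incr. lra.
Qed.

Lemma pow_small (q e : R) : 0 <= q < 1 -> 0 < e -> exists n, q ^ n <= e.
Proof.
  intros Hq He.
  destruct (pow_lt_1_zero q ltac:(rewrite Rabs_pos_eq; lra) e He) as [n Hn].
  exists n. specialize (Hn n (Nat.le_refl _)).
  generalize (Rle_abs (q ^ n)). lra.
Qed.

(** Write [mu = lam ^ 4]. Half of the exponent absorbs [B ^ m], because [n] is a large multiple of
    [m]; the other half is at most [lam ^ (n + m)], because [m <= n]. The lemma is applied on both
    sides of the diagonal, with the roles of row and column exchanged. *)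
Lemma off_window_decay (mu B : R) :
  0 < mu < 1 -> 0 <= B ->
  exists lam L0, 0 < lam < 1 /\ forall L n m : nat, (L0 <= L)%nat ->
    (2 ^ L * m <= n)%nat -> mu ^ n * B ^ m <= lam ^ (n + m).
Proof.
  intros Hmu HB.
  set (lam := sqrt (sqrt mu)).
  assert (H1 : 0 < sqrt mu < 1).
  { split. apply sqrt_lt_R0; lra. rewrite <- sqrt_1. apply sqrt_lt_1; lra. }
  assert (H2 : 0 < lam < 1).
  { unfold lam. split. apply sqrt_lt_R0; lra. rewrite <- sqrt_1. apply sqrt_lt_1; lra. }
  assert (E : mu = lam ^ 2 * lam ^ 2).
  { unfold lam. simpl. rewrite !Rmult_1_r, !sqrt_sqrt; lra. }
  assert (H3 : 0 < lam ^ 2 < 1) by nra.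
  destruct (pow_small (lam ^ 2) (/ (B + 1))) as [p Hp]; [lra|apply Rinv_0_lt_compat; lra|].
  exists lam, p. split; auto. intros L n m HL Hn.
  assert (Hpm : (p * m <= n)%nat).
  { assert (G : (p <= 2 ^ L)%nat).
    { apply Nat.le_trans with L; auto. apply Nat.lt_le_incl, Nat.pow_gt_lin_r. lia. }
    nia. }
  assert (Hmn : (m <= n)%nat).
  { assert (G : (1 <= 2 ^ L)%nat) by (apply Nat.neq_0_lt_0, Nat.pow_nonzero; lia). nia. }
  rewrite E, Rpow_mult_distr.
  assert (A1 : (lam ^ 2) ^ n * B ^ m <= 1).
  { apply Rle_trans with ((lam ^ 2) ^ (p * m) * B ^ m).
    - apply Rmult_le_compat_r. now apply pow_le. apply pow_le_pow_le1; auto; lra.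
    - rewrite pow_mult, <- Rpow_mult_distr, <- (pow1 m). apply pow_incr. split.
      + apply Rmult_le_pos; auto. apply pow_le. lra.
      + apply Rle_trans with (/ (B + 1) * (B + 1)).
        * apply Rmult_le_compat; try lra. apply pow_le; lra.
        * rewrite Rinv_l; lra. }
  assert (A2 : (lam ^ 2) ^ n <= lam ^ (n + m)).
  { rewrite <- pow_mult. apply pow_le_pow_le1. lra. lia. }
  assert (A3 : 0 <= (lam ^ 2) ^ n) by (apply pow_le; lra).
  rewrite Rmult_assoc.
  apply Rle_trans with ((lam ^ 2) ^ n * 1). apply Rmult_le_compat_l; auto. lra.
Qed.

Lemma slowly_oscillating_doubling (beta : nat -> R) :
  weight_pos beta -> slowly_oscillating beta ->
  exists c, 1 <= c /\ forall n m : nat, (1 <= n)%nat -> (n <= 2 * m)%nat -> (m <= 2 * n)%nat ->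
    beta m <= c * beta n.
Proof.
  intros Hb [c1 [c2 [H1 [H2 H]]]]. exists (Rmax c2 1). split. apply Rmax_r.
  intros n m A1 A2 A3. destruct (H n m A1 A2 A3) as [_ U].
  assert (P := Hb n).
  apply Rle_trans with (c2 * beta n).
  - replace (beta m) with (beta m / beta n * beta n) by (field; lra).
    apply Rmult_le_compat_r; lra.
  - apply Rmult_le_compat_r. lra. apply Rmax_l.
Qed.

(** Logarithms within [L] of each other mean a ratio of at most [2 ^ S L], which is crossed by [S L]
    doublings, each costing a factor [c]. *)
Lemma slowly_oscillating_window (beta : nat -> R) (L : nat) :
  weight_pos beta -> slowly_oscillating beta ->
  exists c, 0 < c /\ forall n m : nat,
    (Nat.log2 m <= Nat.log2 n + L)%nat -> (Nat.log2 n <= Nat.log2 m + L)%nat ->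
    beta m <= c * beta n.
Proof.
  intros Hb Hs. destruct (slowly_oscillating_doubling beta Hb Hs) as [c [Hc H]].
  assert (Hdy : forall i n m : nat, (1 <= n)%nat -> (1 <= m)%nat ->
     (n <= 2 ^ i * m)%nat -> (m <= 2 ^ i * n)%nat -> beta m <= c ^ i * beta n).
  { induction i as [|i IH]; intros n m Hn Hm A1 A2.
    - simpl in A1, A2. replace m with n by lia. simpl. lra.
    - rewrite Nat.pow_succ_r' in A1, A2.
      assert (P := Hb n). assert (Pc : 1 <= c ^ i) by now apply pow_R1_Rle.
      destruct (Nat.le_gt_cases m (2 * n)) as [B1|B1].
      + destruct (Nat.le_gt_cases n (2 * m)) as [B2|B2].
        * apply Rle_trans with (c * beta n). now apply H.
          simpl. rewrite Rmult_assoc. apply Rmult_le_compat_l. lra.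
          rewrite <- (Rmult_1_l (beta n)) at 1. apply Rmult_le_compat_r; lra.
        * apply Rle_trans with (c * beta (2 * m)%nat). apply H; lia.
          simpl. rewrite Rmult_assoc. apply Rmult_le_compat_l. lra.
          apply IH; nia.
      + apply Rle_trans with (c ^ i * beta (2 * n)%nat). apply IH; nia.
        simpl. rewrite (Rmult_comm c), Rmult_assoc. apply Rmult_le_compat_l. lra.
        apply H; lia. }
  (* Slow oscillation does not constrain [beta 0], while [Nat.log2 0 = 0] puts index 0 in the block
     of 1. The factor [d] pays for replacing 0 by 1 at both ends. *)
  set (d := Rmax 1 (Rmax (beta 0%nat / beta 1%nat) (beta 1%nat / beta 0%nat))).
  assert (P0 := Hb 0%nat). assert (P1 := Hb 1%nat).
  assert (Hd : 1 <= d) by apply Rmax_l.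
  assert (D0 : beta 0%nat <= d * beta 1%nat).
  { replace (beta 0%nat) with (beta 0%nat / beta 1%nat * beta 1%nat) by (field; lra).
    apply Rmult_le_compat_r. lra. eapply Rle_trans. apply Rmax_l. apply Rmax_r. }
  assert (D1 : beta 1%nat <= d * beta 0%nat).
  { replace (beta 1%nat) with (beta 1%nat / beta 0%nat * beta 0%nat) at 1 by (field; lra).
    apply Rmult_le_compat_r. lra. eapply Rle_trans. apply Rmax_r. apply Rmax_r. }
  assert (Dm : forall n, beta n <= d * beta (Nat.max 1 n) /\ beta (Nat.max 1 n) <= d * beta n).
  { intros [|n]. simpl; auto. replace (Nat.max 1 (S n)) with (S n) by lia.
    assert (P := Hb (S n)). split; nra. }
  exists (d * (c ^ S L * d)). split.
  { assert (0 < c ^ S L) by (apply pow_lt; lra). apply Rmult_lt_0_compat. lra.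
    apply Rmult_lt_0_compat; lra. }
  intros n m A1 A2.
  assert (Lg : forall k, Nat.log2 (Nat.max 1 k) = Nat.log2 k) by (intros [|k]; auto).
  apply Rle_trans with (1 := proj1 (Dm m)). rewrite Rmult_assoc.
  apply Rmult_le_compat_l. lra.
  apply Rle_trans with (c ^ S L * beta (Nat.max 1 n)).
  - assert (Half : forall i j, (Nat.log2 i <= Nat.log2 j + L)%nat ->
       (Nat.max 1 i <= 2 ^ S L * Nat.max 1 j)%nat).
    { intros i j Hij. rewrite <- (Lg i), <- (Lg j) in Hij.
      destruct (Nat.log2_spec (Nat.max 1 i) ltac:(lia)) as [_ U].
      destruct (Nat.log2_spec (Nat.max 1 j) ltac:(lia)) as [V _].
      apply Nat.lt_le_incl. eapply Nat.lt_le_trans. exact U.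
      apply Nat.le_trans with (2 ^ (S L + Nat.log2 (Nat.max 1 j)))%nat.
      - apply Nat.pow_le_mono_r; lia.
      - rewrite Nat.pow_add_r. now apply Nat.mul_le_mono_l. }
    apply Hdy; try lia; now apply Half.
  - rewrite Rmult_assoc. apply Rmult_le_compat_l. apply pow_le; lra. apply Dm.
Qed.

(** Halving the index costs the weight at most the factor [c], while [q ^ (n / 2)] is at most [/ c]
    for large [n]. The two compensate, so the constant found on an initial segment propagates
    unchanged. *)
Lemma slowly_oscillating_subgeometric (beta : nat -> R) (q : R) :
  weight_pos beta -> slowly_oscillating beta -> 0 < q < 1 ->
  exists D, 0 < D /\ forall n, q ^ n <= D * beta n.
Proof.
  intros Hb Hs Hq. destruct (slowly_oscillating_doubling beta Hb Hs) as [c [Hc H]].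
  destruct (pow_small q (/ c)) as [p Hp]; [lra|apply Rinv_0_lt_compat; lra|].
  assert (Hfin : forall N, exists D, 0 < D /\ forall n, (n < N)%nat -> q ^ n <= D * beta n).
  { induction N as [|N [D [HD IH]]].
    - exists 1. split. lra. intros; lia.
    - exists (Rmax D (q ^ N / beta N)). split.
      { eapply Rlt_le_trans. exact HD. apply Rmax_l. }
      intros n Hn. assert (P := Hb n). destruct (Nat.eq_dec n N) as [->|E].
      + apply Rle_trans with (q ^ N / beta N * beta N). right; field; lra.
        apply Rmult_le_compat_r. lra. apply Rmax_r.
      + apply Rle_trans with (1 := IH n ltac:(lia)). apply Rmult_le_compat_r. lra. apply Rmax_l. }
  (* Beyond this threshold [n / 2] is at least [p] and [n - n / 2] is smaller than [n]. *)
  destruct (Hfin (2 * p + 2)%nat) as [D [HD HDn]]. exists D. split; auto.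
  induction n as [n IH] using (well_founded_induction Nat.lt_wf_0).
  destruct (Nat.lt_ge_cases n (2 * p + 2)) as [L|L]; [now apply HDn|].
  set (m := (n - n / 2)%nat).
  assert (E2 := Nat.div_mod n 2 ltac:(lia)). assert (E3 := Nat.mod_upper_bound n 2 ltac:(lia)).
  assert (I := IH m ltac:(unfold m; lia)).
  replace n with (m + n / 2)%nat at 1 by (unfold m; lia). rewrite pow_add.
  assert (Q1 : q ^ (n / 2) <= / c).
  { apply Rle_trans with (q ^ p); auto. apply pow_le_pow_le1. lra. lia. }
  assert (Q2 : beta m <= c * beta n) by (apply H; unfold m; lia).
  assert (P := Hb m). assert (Pn := Hb n).
  apply Rle_trans with (D * beta m * / c).
  - apply Rmult_le_compat; auto; apply pow_le; lra.
  - apply Rle_trans with (D * (c * beta n) * / c).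
    + apply Rmult_le_compat_r. left; apply Rinv_0_lt_compat; lra.
      apply Rmult_le_compat_l; lra.
    + right. field. lra.
Qed.

(** * Windows around the diagonal and the weighted matrix bound *)

Definition log_window (L J n : nat) : bool :=
  (Nat.leb J (Nat.log2 n + L) && Nat.leb (Nat.log2 n) (J + L))%bool.

Lemma log_window_spec (L J n : nat) :
  log_window L J n = true <-> (J <= Nat.log2 n + L)%nat /\ (Nat.log2 n <= J + L)%nat.
Proof. unfold log_window. now rewrite Bool.andb_true_iff, !Nat.leb_le. Qed.

Lemma log_window_count (L n N : nat) :
  rsum (fun J => if log_window L J n then 1 else 0) N <= INR (2 * L + 1).
Proof.
  set (a := Nat.log2 n).
  (* The truncated subtraction counts the [J < N] lying between [a - L] and [a + L]. *)
  assert (H : rsum (fun J => if log_window L J n then 1 else 0) N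
     <= INR (Nat.min N (a + L + 1) - (a - L))).
  { induction N as [|N IH].
    - simpl. lra.
    - cbn [rsum]. destruct (log_window L N n) eqn:E.
      + apply log_window_spec in E. fold a in E.
        replace (Nat.min (S N) (a + L + 1) - (a - L))%nat
          with (S (Nat.min N (a + L + 1) - (a - L))) by lia.
        rewrite S_INR. lra.
      + rewrite Rplus_0_r. apply Rle_trans with (1 := IH). apply le_INR. lia. }
  apply Rle_trans with (1 := H). apply le_INR. lia.
Qed.

(* Dyadic blocks: inside the window |log2 j - log2 m| <= L the weight is constant
   up to a factor, so the unweighted bound applies block by block. *)
Lemma near_diagonal_bound (beta : nat -> R) (A : nat -> nat -> C) (H : R) (L : nat) :
  weight_pos beta -> slowly_oscillating beta -> 0 <= H ->
  (forall n k y, rsum (fun m => Cmod (csum (fun j => (y j * A j m)%C) n) ^ 2) k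
     <= H * rsum (fun j => Cmod (y j) ^ 2) n) ->
  exists M, 0 <= M /\ forall n k x,
    rsum (fun m => Cmod (csum (fun j =>
      ((if log_window L (Nat.log2 m) j then x j else 0%C) * A j m)%C) n) ^ 2 * beta m) k
    <= M * rsum (fun j => Cmod (x j) ^ 2 * beta j) n.
Proof.
  intros Hb Hs HH HA.
  destruct (slowly_oscillating_window beta L Hb Hs) as [c [Hc Hw]].
  exists (c * (c * H) * INR (2 * L + 1)). split.
  { repeat apply Rmult_le_pos; try lra. apply pos_INR. }
  intros n k x.
  set (y := fun J j => if log_window L J j then x j else 0%C).
  set (F := fun J m => Cmod (csum (fun j => (y J j * A j m)%C) n) ^ 2).
  apply Rle_trans with
    (rsum (fun J => (c * beta (2 ^ J)%nat) * rsum (fun m => F J m) k) k).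
  (* Each row [m] is assigned to its block [J = Nat.log2 m]; summing over [J < k] suffices because
     [Nat.log2 m <= m < k]. Within the block, [beta m] is replaced by the weight at [2 ^ J]. *)
  - rewrite (rsum_ext _ (fun m => rsum (fun J => if Nat.eqb J (Nat.log2 m) then F J m * beta m else 0) k)).
    2:{ intros m Hm. rewrite (rsum_single (fun J => F J m * beta m)).
        - reflexivity.
        - apply Nat.le_lt_trans with m; auto. apply Nat.log2_le_lin. lia. }
    rewrite rsum_swap. apply rsum_le. intros J _. rewrite <- rsum_scal.
    apply rsum_le. intros m _.
    assert (PF : 0 <= F J m) by apply pow2_ge_0. assert (Pb := Hb (2 ^ J)%nat).
    destruct (Nat.eqb_spec J (Nat.log2 m)) as [->|_].
    + rewrite Rmult_comm. apply Rmult_le_compat_r; auto.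
      apply Hw; rewrite Nat.log2_pow2; lia.
    + apply Rmult_le_pos; auto. apply Rmult_le_pos; lra.
  (* After the unweighted bound, the weight at [2 ^ J] is traded for [beta j]. Each [j] lies in at
     most [2 * L + 1] windows, which bounds the overlap of the blocks. *)
  - apply Rle_trans with
      (rsum (fun J => rsum (fun j => c * (c * H) * (Cmod (x j) ^ 2 * beta j) * (if log_window L J j then 1 else 0)) n) k).
    + apply rsum_le. intros J _. assert (Pb := Hb (2 ^ J)%nat).
      apply Rle_trans with (c * beta (2 ^ J)%nat * (H * rsum (fun j => Cmod (y J j) ^ 2) n)).
      * apply Rmult_le_compat_l. apply Rmult_le_pos; lra. apply HA.
      * rewrite <- !rsum_scal. apply rsum_le. intros j _. unfold y.
        destruct (log_window L J j) eqn:E.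
        -- apply log_window_spec in E.
           assert (B : beta (2 ^ J)%nat <= c * beta j).
           { apply Hw; rewrite Nat.log2_pow2; lia. }
           assert (X := pow2_ge_0 (Cmod (x j))).
           replace (c * beta (2 ^ J)%nat * (H * Cmod (x j) ^ 2))
             with (beta (2 ^ J)%nat * (c * H * Cmod (x j) ^ 2)) by ring.
           replace (c * (c * H) * (Cmod (x j) ^ 2 * beta j) * 1)
             with (c * beta j * (c * H * Cmod (x j) ^ 2)) by ring.
           apply Rmult_le_compat_r; auto. apply Rmult_le_pos; auto. apply Rmult_le_pos; lra.
        -- rewrite Cmod_0. right. ring.
    + rewrite rsum_swap, <- rsum_scal. apply rsum_le. intros j _.
      rewrite rsum_scal.
      assert (X := pow2_ge_0 (Cmod (x j))). assert (Pb := Hb j).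
      replace (c * (c * H) * INR (2 * L + 1) * (Cmod (x j) ^ 2 * beta j))
        with (c * (c * H) * (Cmod (x j) ^ 2 * beta j) * INR (2 * L + 1)) by ring.
      apply Rmult_le_compat_l; [|apply log_window_count].
      apply Rmult_le_pos; apply Rmult_le_pos; try lra. apply Rmult_le_pos; lra.
Qed.

(** The factor [lam ^ (j + m)] separates the variables. Cauchy-Schwarz with weight [lam ^ j], itself
    at most [D * beta j], bounds each row; the factor [lam ^ m] and [beta m <= K] make the rows
    summable. *)
Lemma off_diagonal_bound (beta : nat -> R) (A : nat -> nat -> C) (K lam : R) :
  weight_pos beta -> (forall n, beta n <= K) -> slowly_oscillating beta -> 0 < lam < 1 ->
  (forall j m, Cmod (A j m) <= lam ^ (j + m)) ->
  exists M, 0 <= M /\ forall n k x,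
    rsum (fun m => Cmod (csum (fun j => (x j * A j m)%C) n) ^ 2 * beta m) k
    <= M * rsum (fun j => Cmod (x j) ^ 2 * beta j) n.
Proof.
  intros Hb HK Hs Hl HA.
  destruct (slowly_oscillating_subgeometric beta lam Hb Hs Hl) as [D [HD HDn]].
  assert (PK : 0 < K) by (apply Rlt_le_trans with (1 := Hb 0%nat); auto).
  assert (Pi : 0 < / (1 - lam)) by (apply Rinv_0_lt_compat; lra).
  set (g := / (1 - lam)) in *.
  exists (g * K * (g * D)). split. { repeat apply Rmult_le_pos; lra. }
  intros n k x. set (S := rsum (fun j => Cmod (x j) ^ 2 * beta j) n).
  assert (PS : 0 <= S).
  { apply rsum_nonneg. intros j. apply Rmult_le_pos. apply pow2_ge_0. left; auto. }
  assert (Hrow : forall m, Cmod (csum (fun j => (x j * A j m)%C) n) ^ 2 <= lam ^ m * (g * D * S)).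
  { intros m.
    assert (Pm : 0 <= lam ^ m <= 1).
    { split. apply pow_le; lra. rewrite <- (pow1 m). apply pow_incr. lra. }
    set (T := rsum (fun j => lam ^ j * Cmod (x j)) n).
    assert (B1 : Cmod (csum (fun j => (x j * A j m)%C) n) <= lam ^ m * T).
    { eapply Rle_trans. apply Cmod_csum_le. unfold T. rewrite <- rsum_scal.
      apply rsum_le. intros j _. rewrite Cmod_mult.
      apply Rle_trans with (Cmod (x j) * lam ^ (j + m)).
      - apply Rmult_le_compat_l; auto. apply Cmod_ge_0.
      - rewrite pow_add. right. ring. }
    assert (B2 : T ^ 2 <= g * (D * S)).
    { eapply Rle_trans. apply weighted_cauchy_schwarz. intros j; apply pow_le; lra.
      apply Rmult_le_compat.
      - apply rsum_nonneg. intros j; apply pow_le; lra.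
      - apply rsum_nonneg. intros j. apply Rmult_le_pos. apply pow_le; lra. apply pow2_ge_0.
      - apply rsum_geom. lra.
      - unfold S. rewrite <- rsum_scal. apply rsum_le. intros j _.
        rewrite (Rmult_comm (Cmod (x j) ^ 2)), <- Rmult_assoc.
        apply Rmult_le_compat_r; auto. apply pow2_ge_0. }
    apply Rle_trans with ((lam ^ m * T) ^ 2).
    - apply pow_incr. split; auto. apply Cmod_ge_0.
    (* One of the two factors [lam ^ m] is given away; the other suffices for the sum over [m]. *)
    - rewrite Rpow_mult_distr. apply Rmult_le_compat; try apply pow2_ge_0.
      + nra.
      + lra. }
  apply Rle_trans with (rsum (fun m => (g * D * S * K) * lam ^ m) k).
  - apply rsum_le. intros m _.
    apply Rle_trans with (lam ^ m * (g * D * S) * K).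
    + apply Rmult_le_compat; auto. apply pow2_ge_0. left; auto.
    + right. ring.
  - rewrite rsum_scal. apply Rle_trans with (g * D * S * K * g).
    + apply Rmult_le_compat_l. repeat apply Rmult_le_pos; lra. apply rsum_geom. lra.
    + right. ring.
Qed.

Lemma Cmod_plus_sqr (u v : C) : Cmod (u + v)%C ^ 2 <= 2 * Cmod u ^ 2 + 2 * Cmod v ^ 2.
Proof.
  apply Rle_trans with ((Cmod u + Cmod v) ^ 2).
  - apply pow_incr. split. apply Cmod_ge_0. apply Cmod_triangle.
  - assert (P := pow2_ge_0 (Cmod u - Cmod v)). nra.
Qed.

Lemma weighted_matrix_bound (beta : nat -> R) (A : nat -> nat -> C) (H K lam : R) (L : nat) :
  weight_pos beta -> (forall n, beta n <= K) -> slowly_oscillating beta ->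
  0 <= H -> 0 < lam < 1 ->
  (forall n k y, rsum (fun m => Cmod (csum (fun j => (y j * A j m)%C) n) ^ 2) k
     <= H * rsum (fun j => Cmod (y j) ^ 2) n) ->
  (forall j m, log_window L (Nat.log2 m) j = false -> Cmod (A j m) <= lam ^ (j + m)) ->
  exists M, 0 <= M /\ forall n k x,
    rsum (fun m => Cmod (csum (fun j => (x j * A j m)%C) n) ^ 2 * beta m) k
    <= M * rsum (fun j => Cmod (x j) ^ 2 * beta j) n.
Proof.
  intros Hb HK Hs HH Hl HA Hfar.
  destruct (near_diagonal_bound beta A H L Hb Hs HH HA) as [M1 [P1 H1]].
  set (A' := fun j m => if log_window L (Nat.log2 m) j then RtoC 0 else A j m).
  destruct (off_diagonal_bound beta A' K lam Hb HK Hs Hl) as [M2 [P2 H2]].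
  { intros j m. unfold A'. destruct (log_window L (Nat.log2 m) j) eqn:E; auto.
    rewrite Cmod_0. apply pow_le; lra. }
  exists (2 * M1 + 2 * M2). split. lra. intros n k x.
  specialize (H1 n k x). specialize (H2 n k x).
  set (u := fun m => csum (fun j =>
      ((if log_window L (Nat.log2 m) j then x j else 0%C) * A j m)%C) n) in *.
  set (v := fun m => csum (fun j => (x j * A' j m)%C) n).
  apply Rle_trans with (rsum (fun m => 2 * (Cmod (u m) ^ 2 * beta m) + 2 * (Cmod (v m) ^ 2 * beta m)) k).
  - apply rsum_le. intros m _.
    replace (csum (fun j => (x j * A j m)%C) n) with (u m + v m)%C.
    + assert (Q := Cmod_plus_sqr (u m) (v m)). assert (Pb := Hb m).
      apply Rle_trans with ((2 * Cmod (u m) ^ 2 + 2 * Cmod (v m) ^ 2) * beta m).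
      * apply Rmult_le_compat_r; lra.
      * right. ring.
    + unfold u, v. rewrite <- csum_plus. apply csum_ext. intros j _. unfold A'.
      destruct (log_window L (Nat.log2 m) j); ring.
  - rewrite rsum_plus, !rsum_scal. unfold u, v. lra.
Qed.

(** * Composition of series *)

(** Stated through a real sequence tending to 0, so that real limit laws and squeezing apply
    directly. *)
Definition Clim (u : nat -> C) (l : C) : Prop :=
  is_lim_seq (fun n => Cmod (u n - l)%C) 0.

Lemma sum_n_csum (t : nat -> C) (n : nat) : @sum_n C_AbelianMonoid t n = csum t (S n).
Proof.
  induction n as [|n IH].
  - rewrite sum_O. simpl. Cring.
  - rewrite sum_Sn, IH. reflexivity.
Qed.

Lemma Clim_is_series (t : nat -> C) (l : C) :
  Clim (csum t) l -> @is_series C_AbsRing C_NormedModule t l.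
Proof.
  intros H P HP. apply locally_Cmod in HP. destruct HP as [d [Hd HP]].
  apply is_lim_seq_spec in H. destruct (H (mkposreal d Hd)) as [N HN]. simpl in HN.
  exists N. intros n Hn. apply HP.
  specialize (HN (S n) ltac:(lia)). rewrite Rminus_0_r, Rabs_pos_eq in HN by apply Cmod_ge_0.
  exact (eq_ind_r (fun s => Cmod (s - l)%C < d) HN (sum_n_csum t n)).
Qed.

Lemma Clim_csum_geom (t : nat -> C) (B q : R) :
  0 <= q < 1 -> (forall n, Cmod (t n) <= B * q ^ n) -> exists l, Clim (csum t) l.
Proof.
  intros Hq Ht.
  assert (E : @ex_series C_AbsRing C_NormedModule t).
  { apply (@ex_series_le C_AbsRing C_CompleteNormedModule t (fun n => B * q ^ n)).
    - exact Ht.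
    - apply (@ex_series_scal R_AbsRing R_NormedModule B (fun n => q ^ n)). apply ex_series_geom. rewrite Rabs_pos_eq; lra. }
  destruct E as [l Hl]. exists l. apply is_lim_seq_incr_1. apply is_lim_seq_spec.
  intros eps.
  assert (He : 0 < eps) by apply cond_pos.
  destruct (Hl (fun y => Cmod (y - l)%C < eps)) as [N HN].
  { apply locally_Cmod. exists eps. auto. }
  exists N. intros n Hn. specialize (HN n Hn). rewrite Rminus_0_r, Rabs_pos_eq by apply Cmod_ge_0.
  rewrite <- sum_n_csum. exact HN.
Qed.

Lemma Clim_squeeze (u : nat -> C) (l : C) (e : nat -> R) :
  (forall n, Cmod (u n - l)%C <= e n) -> is_lim_seq e 0 -> Clim u l.
Proof.
  intros H He. apply is_lim_seq_le_le with (fun _ => 0) e; auto.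
  - intros n. split; auto. apply Cmod_ge_0.
  - apply is_lim_seq_const.
Qed.

Lemma Clim_plus (u v : nat -> C) (l m : C) :
  Clim u l -> Clim v m -> Clim (fun n => (u n + v n)%C) (l + m)%C.
Proof.
  intros Hu Hv. apply Clim_squeeze with (fun n => Cmod (u n - l)%C + Cmod (v n - m)%C).
  - intros n. replace (u n + v n - (l + m))%C with ((u n - l) + (v n - m))%C by ring.
    apply Cmod_triangle.
  - replace (Finite 0) with (Finite (0 + 0)) by (f_equal; ring). now apply is_lim_seq_plus'.
Qed.

Lemma Clim_mult_const (u : nat -> C) (l c : C) :
  Clim u l -> Clim (fun n => (u n * c)%C) (l * c)%C.
Proof.
  intros Hu. apply Clim_squeeze with (fun n => Cmod (u n - l)%C * Cmod c).
  - intros n. replace (u n * c - l * c)%C with ((u n - l) * c)%C by ring.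
    rewrite Cmod_mult. lra.
  - replace (Finite 0) with (Finite (0 * Cmod c)) by (f_equal; ring).
    apply is_lim_seq_mult'; auto. apply is_lim_seq_const.
Qed.

Lemma Clim_csum (u : nat -> nat -> C) (l : nat -> C) (k : nat) :
  (forall m, Clim (fun n => u n m) (l m)) -> Clim (fun n => csum (u n) k) (csum l k).
Proof.
  intros H. induction k as [|k IH]; simpl.
  - apply Clim_squeeze with (fun _ => 0); [|apply is_lim_seq_const].
    intros n. replace (RtoC 0 - RtoC 0)%C with (RtoC 0) by ring. rewrite Cmod_0. lra.
  - now apply Clim_plus.
Qed.

Lemma Clim_Cmod (u : nat -> C) (l : C) :
  Clim u l -> is_lim_seq (fun n => Cmod (u n)) (Cmod l).
Proof.
  intros H. apply is_lim_seq_le_le with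
    (fun n => Cmod l - Cmod (u n - l)%C) (fun n => Cmod l + Cmod (u n - l)%C).
  - intros n. assert (A1 := Cmod_triangle_minus l (u n)). rewrite Cmod_minus_sym in A1.
    assert (A2 := Cmod_triangle_minus (u n) l). lra.
  - replace (Finite (Cmod l)) with (Finite (Cmod l - 0)) by (f_equal; ring).
    apply is_lim_seq_minus'; auto. apply is_lim_seq_const.
  - replace (Finite (Cmod l)) with (Finite (Cmod l + 0)) by (f_equal; ring).
    apply is_lim_seq_plus'; auto. apply is_lim_seq_const.
Qed.

Lemma Clim_Cmod_le (u : nat -> C) (l : C) (c : R) :
  (forall n, Cmod (u n) <= c) -> Clim u l -> Cmod l <= c.
Proof.
  intros H Hu.
  exact (is_lim_seq_le _ _ _ _ H (Clim_Cmod u l Hu) (is_lim_seq_const c)).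
Qed.

(** Fatou's lemma in the form needed: with the number [k] of rows fixed, the limit in [n] passes
    through a finite sum. *)
Lemma Clim_weighted_le (beta : nat -> R) (u : nat -> nat -> C) (l : nat -> C) (k : nat) (c : R) :
  (forall m, Clim (fun n => u n m) (l m)) ->
  (forall n, rsum (fun m => Cmod (u n m) ^ 2 * beta m) k <= c) ->
  rsum (fun m => Cmod (l m) ^ 2 * beta m) k <= c.
Proof.
  intros Hu Hc.
  assert (L : is_lim_seq (fun n => rsum (fun m => Cmod (u n m) ^ 2 * beta m) k)
     (rsum (fun m => Cmod (l m) ^ 2 * beta m) k)).
  { clear Hc. induction k as [|k IH]; simpl. apply is_lim_seq_const.
    apply is_lim_seq_plus'; auto.
    assert (Hk := Clim_Cmod _ _ (Hu k)).
    apply is_lim_seq_mult'; [|apply is_lim_seq_const].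
    apply is_lim_seq_mult'; auto. apply is_lim_seq_mult'; auto. apply is_lim_seq_const. }
  exact (is_lim_seq_le _ _ _ _ Hc L (is_lim_seq_const c)).
Qed.

Lemma rsum_sum_n (f : nat -> R) (n : nat) : sum_n f n = rsum f (S n).
Proof.
  induction n as [|n IH]. rewrite sum_O. simpl. ring.
  rewrite sum_Sn, IH. reflexivity.
Qed.

Lemma rsum_le_Series (f : nat -> R) (n : nat) :
  (forall k, 0 <= f k) -> ex_series f -> rsum f n <= Series f.
Proof.
  intros Hf He. apply Series_correct in He.
  apply Rle_trans with (rsum f (S n)). simpl. specialize (Hf n). lra.
  rewrite <- rsum_sum_n. apply (is_lim_seq_incr_compare (sum_n f)).
  - exact He.
  - intros k. rewrite sum_Sn. unfold plus; simpl. specialize (Hf (S k)). lra.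
Qed.

Lemma ex_series_of_bounded (f : nat -> R) (c : R) :
  (forall k, 0 <= f k) -> (forall n, rsum f n <= c) -> ex_series f /\ Series f <= c.
Proof.
  intros Hf Hc.
  assert (Hb : forall n, sum_n f n <= c) by (intros n; rewrite rsum_sum_n; apply Hc).
  destruct (ex_finite_lim_seq_incr (sum_n f) c) as [l Hl]; auto.
  { intros k. rewrite sum_Sn. unfold plus; simpl. specialize (Hf (S k)). lra. }
  assert (E : is_series f l) by exact Hl.
  split. now exists l. rewrite (is_series_unique _ _ E).
  exact (is_lim_seq_le _ _ _ _ Hb Hl (is_lim_seq_const c)).
Qed.

Lemma Clim_is_pseries (a : nat -> C) (z w : C) :
  Clim (csum (fun k => (a k * z ^ k)%C)) w -> @is_pseries C_AbsRing C_NormedModule a z w.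
Proof.
  intros H. apply Clim_is_series in H. unfold is_pseries.
  eapply is_series_ext; [|exact H]. intros n. change (a n * z ^ n = @pow_n C_Ring z n * a n)%C.
  exact (Cmult_comm _ _).
Qed.

(** * The matrix of [phi ^ n] and its action on coefficient sequences *)

Lemma boundary_modulus_le_1 (phi : C -> C) :
  maps_disk_into_disk phi -> (forall z, Cmod z <= 1 -> continuousC phi z) ->
  forall z, Cmod z <= 1 -> Cmod (phi z) <= 1.
Proof.
  intros Hm Hc z Hz. apply Rnot_lt_le. intros H.
  assert (He : 0 < Cmod (phi z) - 1) by lra.
  destruct (proj1 (locally_Cmod _ _) (proj1 (continuous_Cmod phi z) (Hc z Hz) _ He)) as [d [Hd A]].
  (* The point is approached radially from inside by [(1 - t) * z], where the modulus of [phi] is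
     below 1. *)
  set (t := Rmin (d / 2) (1 / 2)).
  assert (T1 := Rmin_l (d / 2) (1 / 2)). assert (T2 := Rmin_r (d / 2) (1 / 2)).
  assert (T3 : 0 < t) by (apply Rmin_pos; lra). fold t in T1, T2.
  assert (Z := Cmod_ge_0 z).
  specialize (A (RtoC (1 - t) * z)%C).
  assert (B : Cmod (RtoC (1 - t) * z - z)%C < d).
  { replace (RtoC (1 - t) * z - z)%C with (RtoC (- t) * z)%C
      by (rewrite RtoC_minus, RtoC_opp; ring).
    rewrite Cmod_mult, Cmod_R, Rabs_Ropp, Rabs_pos_eq by lra. nra. }
  specialize (A B).
  assert (D : Cmod (phi (RtoC (1 - t) * z)%C) < 1).
  { apply Hm. rewrite Cmod_mult, Cmod_R, Rabs_pos_eq by lra. nra. }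
  assert (E := Cmod_triangle_minus (phi z) (phi (RtoC (1 - t) * z)%C)).
  rewrite Cmod_minus_sym in E. lra.
Qed.

Lemma log2_gap (L i j : nat) :
  (Nat.log2 i + L < Nat.log2 j)%nat -> (2 ^ L * i <= j)%nat.
Proof.
  intros H. destruct i as [|i]; [lia|].
  destruct (Nat.eq_dec j 0) as [->|Hj]; [change (Nat.log2 0) with 0%nat in H; lia|].
  destruct (Nat.log2_spec (S i) ltac:(lia)) as [_ U].
  destruct (Nat.log2_spec j ltac:(lia)) as [V _].
  apply Nat.le_trans with (2 ^ L * 2 ^ S (Nat.log2 (S i)))%nat.
  - apply Nat.mul_le_mono_l. lia.
  - rewrite <- Nat.pow_add_r. apply Nat.le_trans with (2 := V).
    apply Nat.pow_le_mono_r; lia.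
Qed.

Lemma pow_coef_bound (phi : C -> C) (r r' M : R) (j m : nat) :
  0 < r -> 0 < r' -> (forall z, Cmod z <= Rmax r r' -> holo phi z) ->
  (forall z, Cmod z = r -> Cmod (phi z) <= M) ->
  Cmod (taylor_coef (fun z => (phi z ^ j)%C) r' m) <= M ^ j * (/ r) ^ m.
Proof.
  intros Hr Hr' Hh HM.
  assert (M1 := Rmax_l r r'). assert (M2 := Rmax_r r r').
  assert (Hhp : forall z, Cmod z <= Rmax r r' -> holo (fun z => (phi z ^ j)%C) z).
  { intros z Hz. apply holo_pow; auto. }
  assert (E : taylor_coef (fun z => (phi z ^ j)%C) r' m = taylor_coef (fun z => (phi z ^ j)%C) r m).
  { destruct (Rle_dec r r') as [L|L].
    - symmetry. apply taylor_coef_radius; auto. intros z Hz. apply Hhp. lra.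
    - apply (taylor_coef_radius _ r' r m); [auto|lra|]. intros z Hz. apply Hhp. lra. }
  rewrite E. apply taylor_coef_bound; auto.
  - intros z Hz. apply holo_continuous, Hhp. lra.
  - intros z Hz. rewrite Cmod_pow. apply pow_incr. split. apply Cmod_ge_0. auto.
Qed.

Lemma pow_matrix_bound (beta : nat -> R) (phi : C -> C) (R1 : R) :
  weight_pos beta -> weight_bounded_above beta -> slowly_oscillating beta ->
  maps_disk_into_disk phi -> 1 < R1 -> (forall z, Cmod z <= R1 -> holo phi z) ->
  exists M, 0 <= M /\ forall n k x,
    rsum (fun m => Cmod (csum (fun j => (x j * taylor_coef (fun z => (phi z ^ j)%C) 1 m)%C) n) ^ 2 * beta m) k
    <= M * rsum (fun j => Cmod (x j) ^ 2 * beta j) n.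
Proof.
  intros Hb [Kb HKb] Hs Hm HR1 Hh.
  assert (Hc : forall z, Cmod z <= R1 -> continuousC phi z) by (intros; apply holo_continuous; auto).
  assert (H1 : forall z, Cmod z <= 1 -> Cmod (phi z) <= 1).
  { apply boundary_modulus_le_1; auto. intros; apply Hc; lra. }
  destruct (closed_disk_bounded phi R1 Hc) as [K [HK HKR]].
  destruct (closed_disk_lt_1 phi (1 / 2)) as [M [HM HMh]].
  { intros; apply Hc; lra. } { intros; apply Hm; lra. }
  destruct (composition_H2_bound phi) as [H [HH HA]].
  { intros; apply Hh; lra. } { intros; apply H1; lra. } { apply Hm. rewrite Cmod_0. lra. }
  assert (HRi : 0 < / R1 < 1).
  { split. apply Rinv_0_lt_compat; lra. rewrite <- Rinv_1. apply Rinv_lt_contravar; lra. }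
  destruct (off_window_decay M 2) as [l1 [L1 [Hl1 D1]]]; [lra|lra|].
  destruct (off_window_decay (/ R1) K) as [l2 [L2 [Hl2 D2]]]; [lra|lra|].
  set (L := Nat.max L1 L2). set (lam := Rmax l1 l2).
  assert (G1 : l1 <= lam) by apply Rmax_l. assert (G2 : l2 <= lam) by apply Rmax_r.
  assert (G3 : lam < 1) by (apply Rmax_lub_lt; lra).
  apply (weighted_matrix_bound beta _ H Kb lam L); auto; [lra|].
  intros j m Hw. unfold log_window in Hw. apply Bool.andb_false_iff in Hw.
  rewrite !Nat.leb_gt in Hw. destruct Hw as [Hw|Hw]; apply log2_gap in Hw.
  (* Here [m] is at least [2 ^ L * j], and the circle of radius [R1 > 1] gives the decay. *)
  - apply Rle_trans with (K ^ j * (/ R1) ^ m).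
    + apply pow_coef_bound; try lra.
      * intros z Hz. rewrite Rmax_left in Hz by lra. auto.
      * intros z Hz. apply HKR. lra.
    + rewrite Rmult_comm. eapply Rle_trans. apply (D2 L); auto. unfold L; lia.
      rewrite Nat.add_comm. apply pow_incr. lra.
  (* Here [j] is at least [2 ^ L * m], and the decay comes from [Cmod (phi z) <= M] on the circle of
     radius [1 / 2]. *)
  - apply Rle_trans with (M ^ j * (/ (1 / 2)) ^ m).
    + apply pow_coef_bound; try lra.
      * intros z Hz. rewrite Rmax_right in Hz by lra. apply Hh. lra.
      * intros z Hz. apply HMh. lra.
    + replace (/ (1 / 2)) with 2 by field. eapply Rle_trans. apply (D1 L); auto. unfold L; lia.
      apply pow_incr. lra.
Qed.

(** Each term of the norm is at most [S], and [M ^ n <= D * beta n]; so [Cmod (a n) * sqrt M ^ n] is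
    bounded. The other factor [sqrt M ^ n] is left as geometric decay. *)
Lemma H2_coef_geom (beta : nat -> R) (a : nat -> C) (M : R) :
  weight_pos beta -> slowly_oscillating beta -> in_H2 beta a -> 0 < M < 1 ->
  exists B q, 0 <= B /\ 0 < q < 1 /\ forall n, Cmod (a n) * M ^ n <= B * q ^ n.
Proof.
  intros Hb Hs [Ha _] HM.
  destruct (slowly_oscillating_subgeometric beta M Hb Hs HM) as [D [HD HDn]].
  set (S := Series (fun n => Cmod (a n) ^ 2 * beta n)) in *.
  assert (Pos : forall n, 0 <= Cmod (a n) ^ 2 * beta n).
  { intros n. apply Rmult_le_pos. apply pow2_ge_0. left; auto. }
  assert (Ht : forall n, Cmod (a n) ^ 2 * beta n <= S).
  { intros n. apply Rle_trans with (rsum (fun n => Cmod (a n) ^ 2 * beta n) (n + 1)).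
    - rewrite Nat.add_1_r. cbn [rsum].
      assert (P := rsum_nonneg _ n Pos). lra.
    - apply (rsum_le_Series _ _ Pos Ha). }
  exists (sqrt (D * S)), (sqrt M). split. apply sqrt_pos.
  assert (HqM : sqrt M * sqrt M = M) by (apply sqrt_sqrt; lra).
  assert (Hq0 : 0 < sqrt M) by (apply sqrt_lt_R0; lra).
  split. { split; auto. rewrite <- sqrt_1. apply sqrt_lt_1; lra. }
  intros n. rewrite <- HqM at 1. rewrite Rpow_mult_distr, <- Rmult_assoc.
  apply Rmult_le_compat_r. apply pow_le; lra.
  assert (P : 0 <= Cmod (a n) * sqrt M ^ n).
  { apply Rmult_le_pos. apply Cmod_ge_0. apply pow_le; lra. }
  rewrite <- (sqrt_pow2 _ P). apply sqrt_le_1_alt.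
  rewrite Rpow_mult_distr, <- pow_mult, Nat.mul_comm, pow_mult.
  replace (sqrt M ^ 2) with M by (simpl; rewrite Rmult_1_r; auto).
  apply Rle_trans with (Cmod (a n) ^ 2 * (D * beta n)).
  - apply Rmult_le_compat_l; auto. apply pow2_ge_0.
  - replace (Cmod (a n) ^ 2 * (D * beta n)) with (D * (Cmod (a n) ^ 2 * beta n)) by ring.
    apply Rmult_le_compat_l; auto. lra.
Qed.

Lemma partial_composition_remainder (a c : nat -> C) (A : nat -> nat -> C) (z : C) (n k : nat) :
  (csum (fun j => a j * c j) n - csum (fun m => csum (fun j => a j * A j m) n * z ^ m) k =
   csum (fun j => a j * (c j - csum (fun m => A j m * z ^ m) k)) n)%C.
Proof.
  induction n as [|n IH].
  - cbn [csum]. rewrite csum_scal. ring.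
  - cbn [csum]. rewrite <- IH.
    rewrite (csum_ext (fun m => ((csum (fun j => a j * A j m) n + a n * A n m) * z ^ m)%C)
       (fun m => (csum (fun j => a j * A j m) n * z ^ m + a n * (A n m * z ^ m))%C))
      by (intros; ring).
    rewrite csum_plus, csum_scal. ring.
Qed.

(* The remainder estimate for phi^n is summed over n, so no interchange of
   infinite sums is needed. *)
Lemma composition_series (phi : C -> C) (a b : nat -> C) (z : C) :
  maps_disk_into_disk phi -> (forall z, Cmod z <= 1 -> holo phi z) ->
  (forall M, 0 < M < 1 -> exists B q, 0 <= B /\ 0 < q < 1 /\
     forall n, Cmod (a n) * M ^ n <= B * q ^ n) ->
  (forall m, Clim (csum (fun j => (a j * taylor_coef (fun z => (phi z ^ j)%C) 1 m)%C)) (b m)) ->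
  Cmod z < 1 ->
  exists w, Clim (csum (fun k => (a k * phi z ^ k)%C)) w /\
            Clim (csum (fun k => (b k * z ^ k)%C)) w.
Proof.
  intros Hm Hh Ha Hb Hz. assert (Z := Cmod_ge_0 z).
  (* An intermediate circle: [phi] is bounded by some [M < 1] on it, and [Cmod z / r < 1] drives the
     Taylor remainder to 0. *)
  set (r := (1 + Cmod z) / 2).
  assert (Hr : Cmod z < r < 1) by (unfold r; lra).
  destruct (closed_disk_lt_1 phi r) as [M [HM HMr]].
  { intros y Hy. apply holo_continuous, Hh. lra. } { intros y Hy. apply Hm. lra. }
  destruct (Ha M HM) as [B [q [HB [Hq HBq]]]].
  assert (Hw : forall j, Cmod (a j * phi z ^ j)%C <= B * q ^ j).
  { intros j. rewrite Cmod_mult, Cmod_pow. apply Rle_trans with (2 := HBq j).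
    apply Rmult_le_compat_l. apply Cmod_ge_0. apply pow_incr. split. apply Cmod_ge_0.
    apply HMr. lra. }
  destruct (Clim_csum_geom _ B q ltac:(lra) Hw) as [w HL]. exists w. split; auto.
  set (A := fun j m => taylor_coef (fun z => (phi z ^ j)%C) 1 m).
  set (e := fun k => (Cmod z / r) ^ k * (r / (r - Cmod z))).
  assert (He : forall k, 0 <= e k).
  { intros k. apply Rmult_le_pos. apply pow_le. apply Rdiv_le_0_compat; lra.
    apply Rdiv_le_0_compat; lra. }
  (* The bound does not depend on [n], since the remainders of [phi ^ j] are summed against a
     geometric sequence. *)
  assert (HU : forall n k, Cmod (csum (fun j => a j * phi z ^ j)%C n -
     csum (fun m => csum (fun j => a j * A j m) n * z ^ m)%C k)%C <= B * / (1 - q) * e k).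
  { intros n k. rewrite (partial_composition_remainder a (fun j => (phi z ^ j)%C) A z n k).
    eapply Rle_trans. apply Cmod_csum_le.
    apply Rle_trans with (rsum (fun j => (B * e k) * q ^ j) n).
    - apply rsum_le. intros j _. rewrite Cmod_mult.
      apply Rle_trans with (Cmod (a j) * (M ^ j * e k)).
      + apply Rmult_le_compat_l. apply Cmod_ge_0.
        rewrite (csum_ext _ (fun m => (taylor_coef (fun z => (phi z ^ j)%C) r m * z ^ m)%C)).
        * unfold e. rewrite <- Rmult_assoc.
          apply (taylor_remainder (fun z => (phi z ^ j)%C)); try lra.
          -- intros y Hy. apply holo_pow, Hh. lra.
          -- intros y Hy. rewrite Cmod_pow. apply pow_incr. split. apply Cmod_ge_0. apply HMr. lra.
        * intros m _. unfold A. f_equal. symmetry. apply taylor_coef_radius; try lra.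
          intros y Hy. apply holo_pow, Hh. lra.
      + rewrite <- Rmult_assoc. replace (B * e k * q ^ j) with (B * q ^ j * e k) by ring.
        apply Rmult_le_compat_r; auto.
    - rewrite rsum_scal. replace (B * / (1 - q) * e k) with (B * e k * / (1 - q)) by ring.
      apply Rmult_le_compat_l. now apply Rmult_le_pos. apply rsum_geom. lra. }
  apply Clim_squeeze with (fun k => B * / (1 - q) * e k).
  - intros k. rewrite Cmod_minus_sym.
    (* The limit in [n] is taken first, with the Taylor length [k] fixed; the bound [e k] then tends
       to 0. *)
    apply (Clim_Cmod_le _ _ _ (fun n => HU n k)).
    replace (w - csum (fun k => b k * z ^ k)%C k)%C
      with (w + csum (fun k => b k * z ^ k)%C k * (- (1)))%C by ring.
    assert (Hk : Clim (fun n => csum (fun m => csum (fun j => a j * A j m) n * z ^ m)%C k)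
       (csum (fun k => (b k * z ^ k)%C) k)).
    { apply Clim_csum. intros m. apply Clim_mult_const. exact (Hb m). }
    assert (Hs := Clim_plus _ _ _ _ HL (Clim_mult_const _ _ (- (1))%C Hk)).
    apply is_lim_seq_ext with (2 := Hs). intros n. f_equal. ring.
  - replace (Finite 0) with (Finite (B * / (1 - q) * (0 * (r / (r - Cmod z))))) by (f_equal; ring).
    apply is_lim_seq_mult'. apply is_lim_seq_const.
    apply is_lim_seq_mult'; [|apply is_lim_seq_const].
    apply is_lim_seq_geom. rewrite Rabs_pos_eq.
    + apply Rmult_lt_reg_r with r. lra. unfold Rdiv. rewrite Rmult_assoc, Rinv_l; lra.
    + apply Rdiv_le_0_compat; lra.
Qed.

Theorem mainTheorem19 (beta : nat -> R) (phi : C -> C) :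
  weight_pos beta ->
  weight_bounded_above beta ->
  slowly_oscillating beta ->
  maps_disk_into_disk phi ->
  nonconstant_on_disk phi ->
  analytic_near_closed_disk phi ->
  bounded_composition beta phi.
Proof.
  intros Hb HK Hs Hm _ [U [HU [HU1 HUd]]].
  destruct (closed_disk_enlarge U HU HU1) as [R1 [HR1 HR]].
  assert (Hh : forall z, Cmod z <= R1 -> holo phi z).
  { intros z Hz. apply holo_ex_derive. auto. }
  destruct (pow_matrix_bound beta phi R1 Hb HK Hs Hm HR1 Hh) as [M [HM HMx]].
  (* [M] bounds squared norms. *)
  exists (sqrt M). split. apply sqrt_pos.
  intros a Ha.
  assert (Hgeo := fun M => H2_coef_geom beta a M Hb Hs Ha).
  destruct (closed_disk_lt_1 phi (1 / 2)) as [Q [HQ HQh]].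
  { intros; apply holo_continuous, Hh; lra. } { intros; apply Hm; lra. }
  (* The coefficient of index [m] of the composition is an infinite sum over the powers of [phi]. It
     converges absolutely: on the circle of radius [1 / 2] the entries are at most [Q ^ j * 2 ^ m],
     and [Cmod (a j) * Q ^ j] decays geometrically. *)
  assert (Hex : forall m, exists l,
     Clim (csum (fun j => (a j * taylor_coef (fun z => (phi z ^ j)%C) 1 m)%C)) l).
  { intros m. destruct (Hgeo Q HQ) as [B [q [HB [Hq HBq]]]].
    apply Clim_csum_geom with (B * (/ (1 / 2)) ^ m) q. lra.
    intros j. rewrite Cmod_mult.
    apply Rle_trans with (Cmod (a j) * (Q ^ j * (/ (1 / 2)) ^ m)).
    - apply Rmult_le_compat_l. apply Cmod_ge_0. apply pow_coef_bound; try lra.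
      + intros z Hz. rewrite Rmax_right in Hz by lra. apply Hh. lra.
      + intros z Hz. apply HQh. lra.
    - rewrite <- Rmult_assoc. replace (B * (/ (1 / 2)) ^ m * q ^ j) with (B * q ^ j * (/ (1 / 2)) ^ m) by ring.
      apply Rmult_le_compat_r; auto. apply pow_le. lra. }
  set (b := fun m => proj1_sig (constructive_indefinite_description _ (Hex m))).
  assert (Hbl : forall m,
     Clim (csum (fun j => (a j * taylor_coef (fun z => (phi z ^ j)%C) 1 m)%C)) (b m)).
  { intros m. apply (proj2_sig (constructive_indefinite_description _ (Hex m))). }
  assert (Hcomp : forall z, Cmod z < 1 -> exists w,
     @is_pseries C_AbsRing C_NormedModule a (phi z) w /\
     @is_pseries C_AbsRing C_NormedModule b z w).
  { intros z Hz. destruct (composition_series phi a b z) as [w [W1 W2]]; auto.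
    - intros y Hy. apply Hh. lra.
    - exists w. split; now apply Clim_is_pseries. }
  assert (Pa : forall n, 0 <= Cmod (a n) ^ 2 * beta n).
  { intros n. apply Rmult_le_pos. apply pow2_ge_0. left; auto. }
  assert (Pb : forall n, 0 <= Cmod (b n) ^ 2 * beta n).
  { intros n. apply Rmult_le_pos. apply pow2_ge_0. left; auto. }
  destruct (ex_series_of_bounded (fun n => Cmod (b n) ^ 2 * beta n)
     (M * Series (fun n => Cmod (a n) ^ 2 * beta n)) Pb) as [Eb Sb].
  { intros k.
    apply (Clim_weighted_le beta
      (fun n m => csum (fun j => (a j * taylor_coef (fun z => (phi z ^ j)%C) 1 m)%C) n)); auto.
    intros n. eapply Rle_trans. apply HMx. apply Rmult_le_compat_l; auto.
    apply rsum_le_Series; auto. apply Ha. }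
  exists b. split; [|split]; auto.
  - split; auto. intros z Hz. destruct (Hcomp z Hz) as [w [_ W]]. now exists w.
  - unfold H2norm. rewrite <- sqrt_mult_alt by auto. now apply sqrt_le_1_alt.
Qed.
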